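(* There are universal numerical constants $0<c\le C<\infty$ such that the following holds for all integers $n,k\ge1$. Let $p\in[1,2]$, $p^*=\frac{p}{p-1}$ (with $p^*=\infty$ if $p=1$), $X=\{x\in\mathbb{R}^n:\|x\|_p\le1\}$ and $\gamma=\|\cdot\|_{p^*}$. (i) If $1\le p\le1+1/\log(2n)$, then $$c\Big(1\wedge\sqrt{\tfrac{\log(2n)}{k}}\Big)\le\mathfrak{M}^{\mathsf S}_k(X,\gamma)\le\mathfrak{M}^{\mathsf R}_k(X,\gamma)\le C\Big(1\wedge\sqrt{\tfrac{\log(2n)}{k}}\Big).$$ (ii) If $1+1/\log(2n)<p\le2$, then $$c\Big(1\wedge\sqrt{\tfrac{1}{k(p-1)}}\Big)\le\mathfrak{M}^{\mathsf S}_k(X,\gamma)\le\mathfrak{M}^{\mathsf R}_k(X,\gamma)\le C\Big(1\wedge\sqrt{\tfrac{1}{k(p-1)}}\Big).$$ In both cases, mirror descent with distance generating function $h(x)=\frac{1}{2(a-1)}\|x\|_a^2$ for $a=\max\{1+\frac{1}{\log(2n)},p\}$ (with a suitable stepsize) achieves the optimal rate, i.e. its worst-case average regret relative to $X$ over losses in $\mathcal{F}^{\gamma,1}$ is at most the corresponding upper bound.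
   Context: For a norm $\gamma$ on $\mathbb{R}^n$ and a measurable sample space $\mathcal{S}$, $\mathcal{F}^{\gamma,1}$ denotes the functions $F:\mathbb{R}^n\times\mathcal{S}\to\mathbb{R}$, convex in the first argument and measurable in the second, such that $\gamma(g)\le1$ for all $x\in\mathbb{R}^n$, $s\in\mathcal{S}$, $g\in\partial_xF(x,s)$. For a distribution $P$ on $\mathcal{S}$ with $F(x,\cdot)$ $P$-integrable for all $x$, $f_P(x)=\int F(x,s)\,dP(s)$. The minimax stochastic risk is $$\mathfrak{M}^{\mathsf S}_k(X,\gamma)=\sup_{\mathcal{S}}\inf_{\hat x_k}\sup_{F\in\mathcal{F}^{\gamma,1}}\sup_{P}\ \mathbb{E}\Big[f_P(\hat x_k)-\inf_{x\in X}f_P(x)\Big],$$ where $\hat x_k$ is any $\mathbb{R}^n$-valued rule based on the observed functions $F(\cdot,S_1),\dots,F(\cdot,S_k)$, $S_i$ i.i.d. from $P$ (measurable in the samples for each $F$). The average minimax regret is $$\mathfrak{M}^{\mathsf R}_k(X,\gamma)=\sup_{\mathcal{S}}\inf_{\hat x_{1:k}}\sup_{F\in\mathcal{F}^{\gamma,1},\,s_1^k\in\mathcal{S}^k}\sup_{x\in X}\frac1k\sum_{i=1}^k\big[F(\hat x_i,s_i)-F(x,s_i)\big],$$ where $\hat x_i\in\mathbb{R}^n$ is chosen as a function of $F(\cdot,s_1),\dots,F(\cdot,s_{i-1})$ (measurable in the samples for each $F$). Estimates and plays may lie outside $X$. Mirror descent with distance generating function $h$ and stepsize $\alpha>0$ started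 at $x_1=0$: $g_i\in\partial_xF(x_i,s_i)$ and $x_{i+1}=\arg\min_x\{g_i^\top x+\frac1\alpha D_h(x,x_i)\}$, with $D_h(x,y)=h(x)-h(y)-\langle\nabla h(y),x-y\rangle$. Its average regret relative to $X$ is $\sup_{x\in X}\frac1k\sum_{i\le k}[F(x_i,s_i)-F(x,s_i)]$. $a\wedge b=\min\{a,b\}$. *)

(* Defs.v *)
From HB Require Import structures.
From mathcomp Require Import all_boot all_order all_algebra.
From mathcomp Require Import all_classical all_reals all_analysis.

Set Implicit Arguments.
Unset Strict Implicit.
Unset Printing Implicit Defensive.

Import Order.TTheory GRing.Theory Num.Theory.
Import numFieldNormedType.Exports.

Local Open Scope classical_set_scope.
Local Open Scope ring_scope.

Section vectors.
Context {R : realType} {n : nat}.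
Implicit Types x y g : 'rV[R]_n.

Definition dotp x y : R := \sum_(j < n) x 0 j * y 0 j.

(* The l_q norm for q in [1, +oo]; q = -oo is never used. *)
Definition lpnorm (q : \bar R) x : R :=
  match q with
  | r%:E => (\sum_(j < n) `|x 0 j| `^ r) `^ r^-1
  | _ => \big[Num.max/0]_(j < n) `|x 0 j|
  end.

Definition lpball (q : \bar R) : set 'rV[R]_n := [set x | lpnorm q x <= 1].

Definition subdifferential (f : 'rV[R]_n -> R) x : set 'rV[R]_n :=
  [set g | forall y, f x + dotp g (y - x) <= f y].

Definition gradient (h : 'rV[R]_n -> R) x : 'rV[R]_n :=
  \row_(j < n) 'D_(delta_mx 0 j) h x.

Definition bregman (h : 'rV[R]_n -> R) x y : R :=
  h x - h y - dotp (gradient h y) (x - y).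

(* The Borel sigma-algebra of R^n is the product one, so that measurability of
   an R^n-valued map is measurability of its coordinates. *)
Definition measurable_vec d (T : measurableType d) (f : T -> 'rV[R]_n) : Prop :=
  forall j : 'I_n, measurable_fun [set: T] (fun t => f t 0 j).

End vectors.

(* The law of (S_1, ..., S_k) for S_i i.i.d. from P, i.e. the k-fold product of
   P on k.-tuple T with the product sigma-algebra; see iid_lawE. *)
Section iid.
Context {d : measure_display} {T : measurableType d} {R : realType}.

Definition tuple_cons k (x : T * k.-tuple T) : k.+1.-tuple T :=
  [the k.+1.-tuple T of x.1 :: x.2].

Lemma measurable_tuple_cons k : measurable_fun [set: T * k.-tuple T]
  (@tuple_cons k).
Proof. exact: measurable_cons. Qed.

HB.instance Definition _ k := isMeasurableFun.Build _ _ _ _ (@tuple_cons k)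
  (@measurable_tuple_cons k).

Fixpoint iid_law (P : probability T R) (k : nat) : probability (k.-tuple T) R :=
  match k with
  | 0 => [the probability _ _ of \d_([tuple] : 0.-tuple T)]
  | k'.+1 => [the probability _ _ of
      distribution [the probability _ _ of (P \x iid_law P k')%E]
        [the {mfun _ >-> _} of @tuple_cons k']]
  end.

Lemma iid_lawE (P : probability T R) (k : nat) (A : 'I_k -> set T) :
  (forall i, measurable (A i)) ->
  iid_law P k [set s | forall i, A i (tnth s i)] = (\prod_(i < k) P (A i))%E.
Proof.
elim: k A => [|k IH] A mA.
  rewrite big_ord0 /= diracE mem_set//=; by case.
rewrite big_ord_recl /= /pushforward.
have -> : @tuple_cons k @^-1` [set s | forall i, A i (tnth s i)] =
    A ord0 `*` [set s | forall i, A (lift ord0 i) (tnth s i)].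
  apply/seteqP; split => [[x s] /= Axs|[x s] /= [Ax As] i].
    split=> [|i]; first by have := Axs ord0; rewrite (tnth_nth x).
    by have := Axs (lift ord0 i); rewrite !(tnth_nth x).
  case: (unliftP ord0 i) => [j ->|->]; last by rewrite (tnth_nth x).
  by have := As j; rewrite !(tnth_nth x).
rewrite product_measure1E//; last first.
  rewrite (_ : [set s | _] =
      \bigcap_(i in [set: 'I_k]) (@tnth k T ^~ i @^-1` A (lift ord0 i))).
    by apply: fin_bigcap_measurable => // i _; rewrite -[X in measurable X]setTI;
      exact: measurable_tnth.
  by apply/seteqP; split => [s As i _|s As i]; exact: As.
congr (_ * _)%E; exact: (IH (fun i => A (lift ord0 i))).
Qed.

End iid.

Section minimax.
Context {R : realType} {n : nat}.
Local Notation E := 'rV[R]_n.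
Implicit Types (gamma : E -> R) (X : set E) (k : nat).

Section sample_space.
Context {d : measure_display} {T : measurableType d}.

Definition loss_class gamma : set (E -> T -> R) :=
  [set F : E -> T -> R |
          [/\ forall s, @convex_function R E setT (fun x => F x s),
               forall x, measurable_fun [set: T] (F x)
             & forall x s g, subdifferential (fun y => F y s) x g ->
                 gamma g <= 1]].

Definition observed (F : E -> T -> R) (s : seq T) : seq (E -> R) :=
  [seq (fun x => F x t) | t <- s].

Definition population_loss (F : E -> T -> R) (P : probability T R) (x : E) : R :=
  \int[P]_s F x s.

(* Expectation of a loss, the value being +oo (the worst one) whenever the
   positive part is not integrable, including when the negative part is not
   integrable either: the library's integral would then be -oo. *)
Definition expected_loss d' (T' : measurableType d') (Q : probability T' R)
    (Z : T' -> \bar R) : \bar R :=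
  if (\int[Q]_w (Z^\+ w) == +oo)%E then +oo%E else (\int[Q]_w Z w)%E.

(* A rule only sees the list of observed functions. *)
Definition measurable_rule gamma k (xhat : seq (E -> R) -> E) : Prop :=
  forall F, loss_class gamma F ->
    measurable_vec (fun s : k.-tuple T => xhat (observed F s)).

Definition excess_risk X k (xhat : seq (E -> R) -> E)
    (F : E -> T -> R) (P : probability T R) : \bar R :=
  expected_loss (iid_law P k) (fun s : k.-tuple T =>
    ((population_loss F P (xhat (observed F s)))%:E
      - ereal_inf [set (population_loss F P x)%:E | x in X])%E).

Definition worst_excess_risk X gamma k (xhat : seq (E -> R) -> E) : \bar R :=
  ereal_sup [set r | exists F (P : probability T R),
    [/\ loss_class gamma F,
        forall x, P.-integrable [set: T] (EFin \o F x)
      & r = excess_risk X k xhat F P]].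

Definition average_regret k (F : E -> T -> R) (s : k.-tuple T)
    (plays : 'I_k -> E) (x : E) : R :=
  k%:R^-1 * \sum_(i < k) (F (plays i) (tnth s i) - F x (tnth s i)).

(* The play in round i (counted from 0) is the value of the strategy at the list
   of the i functions observed before. *)
Definition strategy_plays k (strat : seq (E -> R) -> E) (F : E -> T -> R)
    (s : k.-tuple T) (i : 'I_k) : E :=
  strat (observed F (take i s)).

Definition worst_regret X gamma k (strat : seq (E -> R) -> E) : \bar R :=
  ereal_sup [set r | exists F (s : k.-tuple T) x,
    [/\ loss_class gamma F, X x
      & r = (average_regret F s (strategy_plays strat F s) x)%:E]].

(* Only y 0, ..., y k and g 0, ..., g (k - 1) matter; y 0 is the starting
   point. *)
Definition mirror_descent_run (h : E -> R) (alpha : R) k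
    (F : E -> T -> R) (s : k.-tuple T) (y g : nat -> E) : Prop :=
  y 0%N = 0 /\
  forall i : 'I_k,
    subdifferential (fun x => F x (tnth s i)) (y i) (g i) /\
    forall z, dotp (g i) (y i.+1) + alpha^-1 * bregman h (y i.+1) (y i)
              <= dotp (g i) z + alpha^-1 * bregman h z (y i).

End sample_space.
Arguments measurable_rule {d} T.
Arguments worst_excess_risk {d} T.
Arguments worst_regret {d} T.

Definition minimax_stochastic_risk k X gamma : \bar R :=
  ereal_sup [set v | exists d (T : measurableType d),
    v = ereal_inf [set worst_excess_risk T X gamma k xhat
                  | xhat in measurable_rule T gamma k]].

Definition minimax_regret k X gamma : \bar R :=
  ereal_sup [set v | exists d (T : measurableType d),
    v = ereal_inf [set worst_regret T X gamma k strat
                  | strat in [set strat | forall i, (i < k)%N ->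
                                measurable_rule T gamma i strat]]].

Definition mirror_descent_worst_regret (h : E -> R) (alpha : R) k X gamma
    : \bar R :=
  ereal_sup [set r | exists d (T : measurableType d) (F : E -> T -> R)
      (s : k.-tuple T) (y g : nat -> E) x,
    [/\ loss_class gamma F, mirror_descent_run h alpha F s y g, X x
      & r = (average_regret F s (fun i => y i) x)%:E]].

(* Subgradients and minimizers exist at every step, so that the supremum above
   is not over an empty set of runs. *)
Definition mirror_descent_defined (h : E -> R) (alpha : R) k gamma : Prop :=
  forall d (T : measurableType d) (F : E -> T -> R) (s : k.-tuple T),
    loss_class gamma F -> exists y g, mirror_descent_run h alpha F s y g.

Definition mirror_descent_attains (h : E -> R) k X gamma (u : R) : Prop :=
  exists alpha : R, [/\ 0 < alpha, mirror_descent_defined h alpha k gamma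
    & (mirror_descent_worst_regret h alpha k X gamma <= u%:E)%E].

End minimax.

(* Main.v *)
Require Import Defs.
From HB Require Import structures.
From mathcomp Require Import all_boot all_order all_algebra.
From mathcomp Require Import all_classical all_reals all_analysis.
From mathcomp Require Import measurable_realfun ring lra.

(** The rate is governed by the exponent [a = max (1 + 1 / L) p], with
    [L = ln (2 n)]: it equals [sqrt (1 / (k (a - 1)))] up to constants, capped
    at 1, and [1 / (a - 1)] is [L] below the threshold and [1 / (p - 1)] above
    it.

    Upper bounds. The [l_a] norm is 2-uniformly convex with constant of order
    [a - 1] ([pnorm_uniform_convexity], from a scalar two-point inequality), so
    that [h] is strongly convex with a constant free of the dimension.
    Subgradients in the dual ball have [l_a]-dual norm at most 4, and the unit
    ball for [p] lies in the one for [a]; hence regularized leaders move by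
    [O(alpha)] per round and their regret is [O(1 / ((a - 1) alpha) + k alpha)]
    ([regularized_leader_regret]). Mirror descent started at 0 without constraint
    is exactly a regularized leader for the linearized losses
    ([mirror_descent_leader]). For the minimax regret the strategy has to be
    measurable in the samples: it plays the first rational point, in a fixed
    enumeration, that nearly minimizes the regularized losses
    ([minimax_regret_rate]).

    From regret to risk. The average of the plays of a strategy has expected
    excess risk at most the regret, by independence and Jensen's inequality. Both
    need integrable plays. As the minimax regret is a supremum over all sample
    spaces, a strategy may be taken on a space enlarged with linear and zero
    losses, where a finite regret bounds the plays ([plays_bounded],
    [online_to_batch]).

    Lower bound. On [m <= n] coordinates take the truncated linear losses
    [max <s, x> (-1) / 4] for random signs [s], one coordinate of which has a
    bias [delta] of unknown place and direction. No point is good for two of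
    these [2 m] hypotheses ([excess_separation]), and a second moment bound on
    the likelihood ratio shows that [k] samples do not identify the hypothesis as
    long as [k * delta ^ 2] is below a constant times [ln (2 m)]
    ([correct_guesses]). The losses belong to the class as soon as
    [m ^ (p - 1) <= 4]: below the threshold [m = n] is allowed, and above it
    [ln (2 m)] can be taken of the order of [1 / (p - 1)]
    ([effective_dimension]). *)

Set Implicit Arguments.
Unset Strict Implicit.
Unset Printing Implicit Defensive.

Import Order.TTheory GRing.Theory Num.Theory.
Import numFieldNormedType.Exports.

Local Open Scope classical_set_scope.
Local Open Scope ring_scope.

(** * Norms and their uniform convexity *)

Section lp_norms.
Context {R : realType}.

(** Two tangent-line bounds, [exp u >= 1 + u] and
    [ln (sqrt t) >= 1 - 1 / sqrt t]. The right-hand side is linear in [t] and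
    [sqrt t], so that adding its values at [1 + t] and [1 - t] leaves only a
    sum of two square roots to estimate. *)
Lemma powR_tangent (r t : R) : 0 <= r -> 0 <= t ->
  t + 2 * r * (t - Num.sqrt t) <= t `^ (1 + r).
Proof.
move=> r0 t_ge0; have [->|t_neq0] := eqVneq t 0.
  by rewrite sqrtr0 subrr mulr0 addr0 powR_ge0.
have t0 : 0 < t by rewrite lt0r t_neq0.
have s0 : 0 < Num.sqrt t by rewrite sqrtr_gt0.
have st : Num.sqrt t * Num.sqrt t = t by rewrite -expr2 sqr_sqrtr// (ltW t0).
rewrite powRD; last by rewrite (gt_eqF t0) implybT.
rewrite powRr1 ?(ltW t0)// /powR (gt_eqF t0).
apply: (@le_trans _ _ (t * (1 + r * ln t))); last first.
  by rewrite ler_pM2l// expR_ge1Dx.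
have -> : ln t = 2 * ln (Num.sqrt t).
  by rewrite -{1}st lnM ?posrE// mulr2n mulrDl mul1r.
have lns : 1 - (Num.sqrt t)^-1 <= ln (Num.sqrt t).
  have := @le_ln1Dx R ((Num.sqrt t)^-1 - 1).
  rewrite (_ : 1 + _ = (Num.sqrt t)^-1); last by ring.
  rewrite lnV ?posrE//.
  have : 0 < (Num.sqrt t)^-1 by rewrite invr_gt0.
  by move=> ? H; have := H ltac:(lra); lra.
have -> : t + 2 * r * (t - Num.sqrt t) = t * (1 + r * (2 * (1 - (Num.sqrt t)^-1))).
  rewrite -{1 2 4}st; field; exact: lt0r_neq0.
by rewrite ler_pM2l// lerD2l ler_wpM2l// ler_wpM2l.
Qed.

(** After adding the tangent bounds at [1 + t] and [1 - t] the linear terms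
    cancel; the gain is the strict concavity of the square root,
    [sqrt (1 + t) + sqrt (1 - t) <= 2 - t ^ 2 / 4]. *)
Lemma two_point_unit (a t : R) : 1 <= a -> 0 <= t <= 1 ->
  1 + (a - 1) / 4 * t ^+ 2 <= ((1 + t) `^ a + (1 - t) `^ a) / 2.
Proof.
move=> a1 /andP[t0 t1].
have r0 : 0 <= a - 1 by lra.
have := @powR_tangent (a - 1) (1 + t) r0 ltac:(lra).
have := @powR_tangent (a - 1) (1 - t) r0 ltac:(lra).
rewrite (_ : 1 + (a - 1) = a); last by ring.
set x := Num.sqrt (1 + t); set y := Num.sqrt (1 - t) => h1 h2.
have x0 : 0 <= x by exact: sqrtr_ge0.
have y0 : 0 <= y by exact: sqrtr_ge0.
have xE : x ^+ 2 = 1 + t by rewrite sqr_sqrtr//; lra.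
have yE : y ^+ 2 = 1 - t by rewrite sqr_sqrtr//; lra.
have T0 : 0 <= t ^+ 2 by exact: sqr_ge0.
have T1 : t ^+ 2 <= 1 by rewrite -(expr1n _ 2) ler_pXn2r ?nnegrE.
have xy : x * y <= 1 - t ^+ 2 / 2.
  rewrite -(@ler_pXn2r _ 2%N)// ?nnegrE; [|by rewrite mulr_ge0|lra].
  rewrite exprMn xE yE; move: T0 T1; set T := t ^+ 2.
  rewrite (_ : (1 + t) * (1 - t) = 1 - T); last by rewrite /T; ring.
  by move=> T0 T1; rewrite expr2; nra.
have sxy : x + y <= 2 - t ^+ 2 / 4.
  rewrite -(@ler_pXn2r _ 2%N)// ?nnegrE; [|by rewrite addr_ge0|lra].
  rewrite sqrrD xE yE; move: T0 T1 xy; set T := t ^+ 2 => T0 T1 xy.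
  by rewrite [leRHS]expr2; rewrite mulr2n; nra.
nra.
Qed.

(** Dividing by the larger of [|u|] and [|v|] reduces to the unit interval; the
    exchange of [u] and [v] is harmless because [(a - 1) / 4 <= 1], and the
    power [a / 2 <= 1] only decreases a number above 1. *)
Lemma two_point (a u v : R) : 1 <= a <= 2 ->
  (u ^+ 2 + (a - 1) / 4 * v ^+ 2) `^ (a / 2) <=
  (`|u + v| `^ a + `|u - v| `^ a) / 2.
Proof.
move=> /andP[a1 a2].
wlog uv : u v / `|v| <= `|u|.
  move=> H; have [/H//|/ltW uv] := leP `|v| `|u|.
  rewrite [u + v]addrC [`|u - v|]distrC; apply: le_trans (H v u uv).
  apply: ge0_ler_powR; rewrite ?nnegrE; [lra|..].
  - by have := sqr_ge0 u; have := sqr_ge0 v; nra.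
  - by have := sqr_ge0 u; have := sqr_ge0 v; nra.
  have : `|u| ^+ 2 <= `|v| ^+ 2 by rewrite ler_pXn2r ?nnegrE.
  rewrite !real_normK ?num_real// => ?; nra.
have [u0|u0] := eqVneq u 0.
  move: uv; rewrite u0 normr0 normr_le0 => /eqP ->.
  rewrite addr0 subr0 normr0 expr0n/= mulr0 addr0 !powR0; [|lra|lra].
  by rewrite addr0 mul0r.
have M0 : 0 < `|u| by rewrite normr_gt0.
set t := `|v| / `|u|.
have t01 : 0 <= t <= 1 by rewrite divr_ge0//= ler_pdivrMr// mul1r.
have vt : `|v| = `|u| * t by rewrite /t mulrCA mulfV ?mulr1// normr_eq0.
have -> : `|u + v| `^ a + `|u - v| `^ a =
    `|u| `^ a * ((1 + t) `^ a + (1 - t) `^ a).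
  have -> : `|u + v| `^ a + `|u - v| `^ a =
      (`|u| + `|v|) `^ a + (`|u| - `|v|) `^ a.
    have [u_ge0|u_lt0] := leP 0 u; have [v_ge0|v_lt0] := leP 0 v;
      rewrite ?(ger0_norm u_ge0) ?(ltr0_norm u_lt0) ?(ger0_norm v_ge0)
        ?(ltr0_norm v_lt0) in uv *.
    - by rewrite !ger0_norm//; lra.
    - by rewrite addrC opprK !ger0_norm//; lra.
    - rewrite !ler0_norm; [rewrite addrC; congr (_ `^ a + _ `^ a); ring|lra|lra].
    - rewrite !ler0_norm; [congr (_ `^ a + _ `^ a); ring|lra|lra].
  rewrite vt mulrDr -!powRM//; [|lra|lra].
  by congr (_ `^ a + _ `^ a); ring.
have -> : u ^+ 2 + (a - 1) / 4 * v ^+ 2 =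
    `|u| ^+ 2 * (1 + (a - 1) / 4 * t ^+ 2).
  by rewrite -(real_normK (num_real u)) -(real_normK (num_real v)) vt; ring.
have h1 : 1 <= 1 + (a - 1) / 4 * t ^+ 2.
  by rewrite lerDl mulr_ge0 ?sqr_ge0//; lra.
rewrite powRM ?sqr_ge0//; last by rewrite (le_trans _ h1).
rewrite -powR_mulrn// -powRrM (_ : 2%:R * (a / 2) = a); last by field.
rewrite -[leRHS]mulrA ler_pM2l ?powR_gt0//.
apply: le_trans (two_point_unit a1 t01).
by apply: ler1_powR => //; lra.
Qed.

End lp_norms.

(** Kept opaque, since comparing two real powers by unfolding them is very
    costly. *)
HB.lock Definition pnorm {R : realType} {n : nat} (a : R) (x : 'rV[R]_n) : R :=
  lpnorm a%:E x.

Section finite_dim.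
Variable R : realType.
Variable n : nat.
Implicit Types (x y u d : 'rV[R]_n) (a q c : R).
Local Notation N a := (@pnorm R n a).

Lemma pnormE a x : N a x = (\sum_(j < n) `|x 0 j| `^ a) `^ a^-1.
Proof. by rewrite unlock. Qed.

Lemma lpnormE a x : lpnorm a%:E x = N a x.
Proof. by rewrite unlock. Qed.

Lemma dotpC x y : dotp x y = dotp y x.
Proof. by apply: eq_bigr => j _; rewrite mulrC. Qed.

Lemma dotpDl x y u : dotp (x + y) u = dotp x u + dotp y u.
Proof. by rewrite /dotp -big_split; apply: eq_bigr => j _; rewrite mxE mulrDl. Qed.

Lemma dotpZl c x u : dotp (c *: x) u = c * dotp x u.
Proof. by rewrite /dotp mulr_sumr; apply: eq_bigr => j _; rewrite mxE mulrA. Qed.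

Lemma dotpNl x u : dotp (- x) u = - dotp x u.
Proof. by rewrite -scaleN1r dotpZl mulN1r. Qed.

Lemma dotp0l u : dotp 0 u = 0.
Proof. by rewrite /dotp big1// => j _; rewrite mxE mul0r. Qed.

Lemma dotpDr u x y : dotp u (x + y) = dotp u x + dotp u y.
Proof. by rewrite !(dotpC u) dotpDl. Qed.

Lemma dotpZr u c x : dotp u (c *: x) = c * dotp u x.
Proof. by rewrite !(dotpC u) dotpZl. Qed.

Lemma dotpNr u x : dotp u (- x) = - dotp u x.
Proof. by rewrite !(dotpC u) dotpNl. Qed.

Lemma dotp0r u : dotp u 0 = 0.
Proof. by rewrite dotpC dotp0l. Qed.

Lemma dotp_delta x j : dotp x (delta_mx 0 j) = x 0 j.
Proof.
rewrite /dotp (bigD1 j)//= mxE !eqxx mulr1 big1 ?addr0// => i ij.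
by rewrite mxE (negbTE ij) mulr0.
Qed.

Lemma pnorm_ge0 a x : 0 <= N a x. Proof. by rewrite pnormE powR_ge0. Qed.

Lemma powsum_ge0 a x : 0 <= \sum_(j < n) `|x 0 j| `^ a.
Proof. by apply: sumr_ge0 => j _; exact: powR_ge0. Qed.

Lemma powR_pnorm a x : 0 < a -> N a x `^ a = \sum_(j < n) `|x 0 j| `^ a.
Proof.
by move=> a0; rewrite pnormE -powRrM mulVf ?(gt_eqF a0)// powRr1// powsum_ge0.
Qed.

Lemma pnormZ a c x : 0 < a -> N a (c *: x) = `|c| * N a x.
Proof.
move=> a0; rewrite !pnormE.
have -> : \sum_(j < n) `|(c *: x) 0 j| `^ a =
    `|c| `^ a * \sum_(j < n) `|x 0 j| `^ a.
  by rewrite mulr_sumr; apply: eq_bigr => j _; rewrite mxE normrM powRM.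
by rewrite powRM ?powR_ge0 ?powsum_ge0// -powRrM mulfV ?(gt_eqF a0)// powRr1.
Qed.

Lemma pnormN a x : 0 < a -> N a (- x) = N a x.
Proof. by move=> a0; rewrite -scaleN1r pnormZ// normrN1 mul1r. Qed.

Lemma pnorm0 a : 0 < a -> N a 0 = 0.
Proof. by move=> a0; rewrite -(scale0r (0 : 'rV_n)) pnormZ// normr0 mul0r. Qed.

Lemma pnorm_eq0 a x : 0 < a -> N a x = 0 -> x = 0.
Proof.
move=> a0; rewrite pnormE => /powR_eq0_eq0/eqP; rewrite psumr_eq0 => [/allP h|j _];
  last exact: powR_ge0.
apply/rowP => j; rewrite mxE; have := h j; rewrite mem_index_enum => /(_ isT).
by rewrite implyTb powR_eq0 normr_eq0 => /andP[/eqP].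
Qed.

Lemma coord_le_pnorm a x j : 0 < a -> `|x 0 j| <= N a x.
Proof.
move=> a0; rewrite pnormE -[leLHS]powRr1// -(mulfV (lt0r_neq0 a0)) powRrM.
rewrite ge0_ler_powR ?nnegrE ?powR_ge0 ?powsum_ge0 ?invr_ge0 ?(ltW a0)//.
by rewrite (bigD1 j)//= lerDl sumr_ge0// => i _; exact: powR_ge0.
Qed.

Lemma pnorm_le1 a x : 0 < a ->
  (N a x <= 1) = (\sum_(j < n) `|x 0 j| `^ a <= 1).
Proof.
move=> a0; apply/idP/idP => h.
  rewrite -powR_pnorm//; apply: le_trans (ge0_ler_powR (ltW a0) _ _ h) _;
    by rewrite ?nnegrE ?pnorm_ge0 ?powR1.
rewrite pnormE; have ia0 : 0 <= a^-1 by rewrite invr_ge0 ltW.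
by apply: le_trans (ge0_ler_powR ia0 _ _ h) _; rewrite ?nnegrE ?powsum_ge0 ?powR1.
Qed.

(** Young's inequality, summed over normalised coordinates. *)
Lemma hoelder_dotp a q x y : 0 < a -> 0 < q -> a^-1 + q^-1 = 1 ->
  `|dotp x y| <= N q x * N a y.
Proof.
move=> a0 q0 aq.
have [x0|x0] := eqVneq (N q x) 0.
  by rewrite (pnorm_eq0 q0 x0) dotp0l normr0 pnorm0// mul0r.
have [y0|y0] := eqVneq (N a y) 0.
  by rewrite (pnorm_eq0 a0 y0) dotp0r normr0 pnorm0// mulr0.
have X0 : 0 < N q x by rewrite lt0r x0 pnorm_ge0.
have Y0 : 0 < N a y by rewrite lt0r y0 pnorm_ge0.
have XY0 := mulr_gt0 X0 Y0.
suff h : \sum_(j < n) (`|y 0 j| / N a y) * (`|x 0 j| / N q x) <= 1.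
  apply: (@le_trans _ _ (N q x * N a y *
      \sum_(j < n) (`|y 0 j| / N a y) * (`|x 0 j| / N q x))).
    rewrite mulr_sumr; apply: le_trans (ler_norm_sum _ _ _) _.
    apply: ler_sum => j _; rewrite normrM le_eqVlt; apply/orP; left; apply/eqP.
    move: x0 y0; move: (N q x) (N a y) => p r p0 r0.
    by field; rewrite p0 r0.
  by rewrite -[leRHS]mulr1 ler_pM2l.
apply: (@le_trans _ _ (\sum_(j < n) ((`|y 0 j| / N a y) `^ a / a +
                                     (`|x 0 j| / N q x) `^ q / q))).
  apply: ler_sum => j _; apply: conjugate_powR => //; by rewrite divr_ge0// pnorm_ge0.
rewrite big_split/= -!mulr_suml.
have nrm (b : R) z : 0 < b -> 0 < N b z ->
    \sum_(i < n) (`|z 0 i| / N b z) `^ b = 1.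
  move=> b0 z0; under eq_bigr do rewrite powRM ?invr_ge0 ?(ltW z0)//.
  rewrite -mulr_suml -powR_pnorm// -powRM ?invr_ge0 ?(ltW z0)//.
  by rewrite mulfV ?(gt_eqF z0)// powR1.
by rewrite !nrm// !mul1r aq.
Qed.

(** The duality map of the [l_q] norm: equality case of Hoelder's inequality. *)
Lemma dual_vector a q x : 0 < a -> 0 < q -> a^-1 + q^-1 = 1 ->
  exists u, N a u = N q x /\ dotp x u = N q x ^+ 2.
Proof.
move=> a0 q0 aq.
have [x0|x0] := eqVneq (N q x) 0.
  by exists 0; rewrite pnorm0// dotp0r x0 expr0n.
have X0 : 0 < N q x by rewrite lt0r x0 pnorm_ge0.
pose v : 'rV_n := \row_j (Num.sg (x 0 j) * `|x 0 j| `^ (q - 1)).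
have q1 : q - 1 = q / a.
  have -> : a^-1 = 1 - q^-1 by rewrite -aq addrK.
  by field; exact: lt0r_neq0.
have q1gt : 0 < q - 1 by rewrite q1 divr_gt0.
have vn : N a v = N q x `^ (q - 1).
  rewrite q1 (powRrM (N q x) q) powR_pnorm// pnormE.
  congr (_ `^ _); apply: eq_bigr => j _; rewrite mxE normrM normr_sg (ger0_norm (powR_ge0 _ _)).
  have [xj|xj] := eqVneq (x 0 j) 0.
    by rewrite xj normr0 mul0r !powR0// gt_eqF.
  by rewrite mul1r -powRrM q1 -mulrA mulVf ?mulr1// gt_eqF.
have xv : dotp x v = N q x * N q x `^ (q - 1).
  rewrite mulr_powRB1 ?pnorm_ge0// powR_pnorm//; apply: eq_bigr => j _.
  by rewrite mxE mulrA [_ * Num.sg _]mulrC -normrEsg mulr_powRB1.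
exists ((N q x / N q x `^ (q - 1)) *: v).
have P0 : 0 < N q x `^ (q - 1) by rewrite powR_gt0.
rewrite pnormZ// dotpZr xv vn ger0_norm ?divr_ge0 ?ltW//.
split; move: P0; move: (N q x) (N q x `^ _) => r s s0;
  by field; rewrite gt_eqF.
Qed.

End finite_dim.

Section strong_convexity.
Context {R : realType}.
Implicit Types a s : R.

Lemma powRrK s (t : R) : s != 0 -> 0 <= t -> (t `^ s) `^ s^-1 = t.
Proof. by move=> s0 t0; rewrite -powRrM mulfV// powRr1. Qed.

Lemma powRrVK s (t : R) : s != 0 -> 0 <= t -> (t `^ s^-1) `^ s = t.
Proof. by move=> s0 t0; rewrite -powRrM mulVf// powRr1. Qed.

(** Hoelder's inequality for two terms, with exponents [1 / (1 - s)] and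
    [1 / s]. *)
Lemma powR_mix s (al be A B : R) : 0 < s < 1 ->
  0 <= al -> 0 <= be -> 0 <= A -> 0 <= B ->
  al `^ (1 - s) * A `^ s + be `^ (1 - s) * B `^ s
    <= (al + be) `^ (1 - s) * (A + B) `^ s.
Proof.
move=> /andP[s0 s1] al0 be0 A0 B0.
have s'0 : 0 < 1 - s by rewrite subr_gt0.
have := @hoelder2 R _ _ _ _ (1 - s)^-1 s^-1 (powR_ge0 al (1 - s))
  (powR_ge0 be (1 - s)) (powR_ge0 A s) (powR_ge0 B s).
rewrite !invr_gt0 s'0 s0 !invrK subrK => /(_ isT isT erefl).
rewrite (powRrK (lt0r_neq0 s'0) al0) (powRrK (lt0r_neq0 s'0) be0).
by rewrite (powRrK (lt0r_neq0 s0) A0) (powRrK (lt0r_neq0 s0) B0).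
Qed.

(** Minkowski's inequality is reversed for exponents below 1. For
    [s = a / 2] it bounds a sum of two squared [l_a] norms by a power of a sum
    over the coordinates, to each term of which a scalar inequality applies. *)
Lemma reverse_minkowski n s (A B : 'I_n -> R) : 0 < s <= 1 ->
  (forall j, 0 <= A j) -> (forall j, 0 <= B j) ->
  (\sum_j A j `^ s) `^ s^-1 + (\sum_j B j `^ s) `^ s^-1
    <= (\sum_j (A j + B j) `^ s) `^ s^-1.
Proof.
move=> /andP[s0 s1] A0 B0.
have sA : 0 <= \sum_j A j `^ s by apply: sumr_ge0 => j _; exact: powR_ge0.
have sB : 0 <= \sum_j B j `^ s by apply: sumr_ge0 => j _; exact: powR_ge0.
have sAB : 0 <= \sum_j (A j + B j) `^ s by apply: sumr_ge0 => j _; exact: powR_ge0.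
have sn0 := lt0r_neq0 s0.
have al0 := powR_ge0 (\sum_j A j `^ s) s^-1.
have alE := powRrVK sn0 sA.
have be0 := powR_ge0 (\sum_j B j `^ s) s^-1.
have beE := powRrVK sn0 sB.
move: al0 alE be0 beE.
move: (_ `^ s^-1) => al al0 alE; move: (_ `^ s^-1) => be be0 beE.
suff H : (al + be) `^ s <= \sum_j (A j + B j) `^ s.
  rewrite -[leLHS](powRrK sn0) ?addr_ge0//; apply: ge0_ler_powR => //.
  - by rewrite invr_ge0 ltW.
  - by rewrite nnegrE powR_ge0.
have [sE|sn1] := eqVneq s 1.
  rewrite sE powRr1 ?addr_ge0//; move: alE beE; rewrite sE !powRr1// => -> ->.
  rewrite -big_split/= le_eqVlt; apply/orP; left; apply/eqP.
  by apply: eq_bigr => j _; rewrite !powRr1 ?addr_ge0.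
have s1' : s < 1 by rewrite lt_neqAle sn1.
have [ab0|ab0] := eqVneq (al + be) 0; first by rewrite ab0 powR0.
have abgt : 0 < al + be by rewrite lt0r ab0 addr_ge0.
have pgt := powR_gt0 (1 - s) abgt.
rewrite -(ler_pM2l pgt) -powRD; last by rewrite subrK oner_eq0.
rewrite subrK powRr1 ?(ltW abgt)//.
have split1 (t : R) : 0 <= t -> t `^ (1 - s) * t `^ s = t.
  move=> t0; rewrite -powRD; last by rewrite subrK oner_eq0.
  by rewrite subrK powRr1.
rewrite -{1}(split1 _ al0) -{1}(split1 _ be0) alE beE !mulr_sumr -big_split/=.
apply: ler_sum => j _; apply: powR_mix => //; exact/andP.
Qed.

Lemma powR_mean a (x y : R) : 1 <= a -> 0 <= x -> 0 <= y ->
  ((x + y) / 2) `^ a <= (x `^ a + y `^ a) / 2.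
Proof.
move=> a1 x0 y0.
have half : (0 <= 2^-1 :> R) && (2^-1 <= 1 :> R) by apply/andP; split; lra.
have := @convex_powR R a a1 (Itv01 (proj1 (andP half)) (proj2 (andP half))) x y.
rewrite !inE/= !in_itv/= !andbT => /(_ x0 y0).
rewrite [X in X `^ a <= _ -> _]convRE convRE/= /unstable.onem.
rewrite (_ : 1 - 2^-1 = 2^-1 :> R); last by field.
by rewrite -!mulrDr ![2^-1 * _]mulrC.
Qed.

Section pnorm.
Variable n : nat.
Implicit Types x y u v : 'rV[R]_n.
Local Notation N a := (@pnorm R n a).

Let half_powsum a (c : R) u : 0 < a -> 0 <= c ->
  (\sum_(j < n) (c * u 0 j ^+ 2) `^ (a / 2)) `^ (a / 2)^-1 = c * N a u ^+ 2.
Proof.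
move=> a0 c0; have a20 : 0 < a / 2 by rewrite divr_gt0.
have -> : \sum_(j < n) (c * u 0 j ^+ 2) `^ (a / 2) = c `^ (a / 2) * N a u `^ a.
  rewrite powR_pnorm// mulr_sumr; apply: eq_bigr => j _.
  rewrite powRM ?sqr_ge0//; congr (_ * _).
  rewrite -(real_normK (num_real (u 0 j))) -powR_mulrn// -powRrM.
  by congr (_ `^ _); field.
rewrite powRM ?powR_ge0//; congr (_ * _).
  by rewrite powRrK// lt0r_neq0.
rewrite -powRrM -powR_mulrn ?pnorm_ge0//; congr (_ `^ _).
by field; exact: lt0r_neq0.
Qed.

(** The [l_a] norm is 2-uniformly convex, with a constant of order [a - 1]: the
    scalar two-point inequality, summed over the coordinates. This constant is
    why the rate carries [1 / (a - 1)] instead of the dimension. *)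
Lemma pnorm_uniform_convexity a u v : 1 < a <= 2 ->
  N a u ^+ 2 + (a - 1) / 4 * N a v ^+ 2 <=
  (N a (u + v) ^+ 2 + N a (u - v) ^+ 2) / 2.
Proof.
move=> /andP[a1 a2]; have a0 : 0 < a by lra.
have a20 : 0 < a / 2 by rewrite divr_gt0.
have c0 : 0 <= (a - 1) / 4 by lra.
rewrite -[N a u ^+ 2]mul1r -!half_powsum//.
apply: le_trans (reverse_minkowski _ _ _) _.
- by rewrite a20/=; lra.
- by move=> j; rewrite mul1r sqr_ge0.
- by move=> j; rewrite mulr_ge0 ?sqr_ge0.
set P := N a (u + v); set Q := N a (u - v).
have P0 : 0 <= P by exact: pnorm_ge0.
have Q0 : 0 <= Q by exact: pnorm_ge0.
have sqE (t : R) : 0 <= t -> t ^+ 2 = (t `^ a) `^ (a / 2)^-1.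
  move=> t0; rewrite -powRrM -powR_mulrn//; congr (_ `^ _).
  by field; exact: lt0r_neq0.
rewrite (sqE P)// (sqE Q)//.
apply: le_trans (powR_mean _ (powR_ge0 P a) (powR_ge0 Q a)); last first.
  by rewrite -[leLHS]invr1 lef_pV2 ?posrE//; lra.
apply: ge0_ler_powR.
- by rewrite invr_ge0 ltW.
- by rewrite nnegrE sumr_ge0// => j _; exact: powR_ge0.
- by rewrite nnegrE divr_ge0// addr_ge0// powR_ge0.
rewrite !powR_pnorm// -big_split/= mulr_suml; apply: ler_sum => j _.
rewrite mul1r !mxE; apply: two_point; lra.
Qed.
End pnorm.
End strong_convexity.

(** * The distance generating function *)

Section generating_function.
Context {R : realType}.
Implicit Types (a : R).

(** At 0 the difference quotient has absolute value [|t| ^ (a - 1)]. *)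
Lemma derivable_normr_powR a (x : R) : 1 < a ->
  derivable (fun t : R => `|t| `^ a) x 1.
Proof.
move=> a1; have [x0|x0|->] := ltgtP x 0.
- apply: (@near_eq_derivable _ _ _ ((@powR R ^~ a) \o -%R)).
    near=> t; rewrite /= ltr0_norm//; near: t.
    exact: lt_nbhsl.
  have nx0 : 0 < - x by rewrite oppr_gt0.
  by have [] := is_derive1_comp (is_derive1_powR a nx0) (is_deriveNid x 1).
- apply: (@near_eq_derivable _ _ _ (@powR R ^~ a)).
    near=> t; rewrite ger0_norm//; apply/ltW; near: t.
    exact: lt_nbhsr.
  by have [] := is_derive1_powR a x0.
- apply/cvg_ex; exists 0 => /=.
  apply/cvgr0Pnorm_lt => e e0.
  have r0 : 0 < (a - 1)^-1 by rewrite invr_gt0 subr_gt0.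
  near=> t.
  have t0 : t != 0 by near: t; exact: nbhs_dnbhs_neq.
  have nt0 : 0 < `|t| by rewrite normr_gt0.
  rewrite normr0 powR0; last by rewrite gt_eqF// (lt_trans _ a1).
  rewrite addr0 subr0 [_%:A]mulr1 normrZ normfV (ger0_norm (powR_ge0 _ _)).
  rewrite -(@mulr_powRB1 _ `|t| a)//; last by rewrite (lt_trans _ a1).
  rewrite mulrA mulVf ?gt_eqF// mul1r.
  have -> : e = (e `^ (a - 1)^-1) `^ (a - 1).
    by rewrite -powRrM mulVf ?powRr1 ?(ltW e0)// gt_eqF// subr_gt0.
  apply: gt0_ltr_powR; rewrite ?nnegrE ?powR_ge0 ?subr_gt0//.
  near: t; apply: dnbhs0_lt; exact: powR_gt0.
Unshelve. all: by end_near. Qed.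

(** The squared norm along a line parallel to an axis; [A] collects the other
    coordinates. The outer power is singular only where its base vanishes, and
    there [A = 0], so that the whole function is a multiple of the square of
    [b + t]. *)
Lemma derivable_shifted_powsum a (A b c t : R) : 1 < a -> 0 <= A ->
  derivable (fun t : R => c * (A + `|b + t| `^ a) `^ (2 / a)) t 1.
Proof.
move=> a1 A0; have a0 : 0 < a by rewrite (lt_trans _ a1).
have db : is_derive t 1 (fun t : R => b + t) 1.
  rewrite (_ : (fun _ => _) = shift b); first exact: is_derive_shift.
  by apply/funext => s; rewrite /= addrC.
have [S0|S0] := eqVneq (A + `|b + t| `^ a) 0.
  move: S0 => /eqP; rewrite paddr_eq0 ?powR_ge0// => /andP[/eqP -> _].
  rewrite (_ : (fun _ => _) = (fun t => c * (b + t) ^+ 2)); last first.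
    apply/funext => s; rewrite add0r -powRrM mulrCA mulfV ?gt_eqF// mulr1.
    by rewrite powR_mulrn// real_normK// num_real.
  case: db => db _; apply: (@derivableZ _ _ _ (fun t => (b + t) ^+ 2)).
  exact: (@derivableX _ _ _ 2 _ _ db).
have Spos : 0 < A + `|b + t| `^ a by rewrite lt0r S0 addr_ge0// powR_ge0.
have dg := is_derive1_comp (derivableP (@derivable_normr_powR a (b + t) a1)) db.
have dA : is_derive t 1 (fun t : R => A + `|b + t| `^ a)
    ('D_1 (fun t : R => `|t| `^ a) (b + t) * 1).
  rewrite -[X in is_derive _ _ _ X]add0r.
  exact: (@is_deriveD _ _ _ (cst A) _ _ _ _ _ (is_derive_cst _ _ _) dg).
have [h _] := @is_derive1_comp _ (@powR R ^~ (2 / a))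
  (fun t => A + `|b + t| `^ a) _ _ _ (is_derive1_powR (2 / a) Spos) dA.
exact: (@derivableZ _ _ _ (fun t => (A + `|b + t| `^ a) `^ (2 / a))).
Qed.

Section dgf.
Variable n : nat.
Implicit Types x y z th : 'rV[R]_n.
Local Notation N a := (@pnorm R n a).

Definition dgf a x : R := 1 / (2 * (a - 1)) * N a x ^+ 2.

Lemma dgf_ge0 a x : 1 < a -> 0 <= dgf a x.
Proof.
by move=> a1; rewrite mulr_ge0 ?sqr_ge0// divr_ge0// mulr_ge0// subr_ge0 ltW.
Qed.

Lemma dgf0 a : 1 < a -> dgf a 0 = 0.
Proof. by move=> a1; rewrite /dgf pnorm0 ?expr0n ?mulr0// (lt_trans _ a1). Qed.

Lemma pnorm_ord1 a : n = 1%N -> 0 < a -> exists j, forall y, N a y = `|y 0 j|.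
Proof.
move=> n1 a0; subst n; exists ord0 => y.
by rewrite pnormE big_ord1 -powRrM mulfV ?gt_eqF// powRr1.
Qed.

(** Strong convexity at midpoints: uniform convexity applied to the half sum and
    the half difference of [x] and [y]. In dimension 1 every [l_a] norm is the
    absolute value and the parallelogram identity gives the same gain up to
    [a = 3]; this covers the exponent [1 + 1 / ln 2], which exceeds 2. *)
Lemma dgf_midconvex a x y : (1 < a <= 2) || (n == 1%N) && (1 < a <= 3) ->
  dgf a (2^-1 *: (x + y)) <= (dgf a x + dgf a y) / 2 - N a (x - y) ^+ 2 / 32.
Proof.
have dgfE z : dgf a z = (a - 1)^-1 / 2 * N a z ^+ 2.
  by rewrite /dgf div1r invfM mulrC [_ * 2^-1]mulrC mulrC.
rewrite !dgfE; case/orP => [a12|/andP[/eqP n1 /andP[a1 a3]]].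
  have /andP[a1 a2] := a12; have a0 : 0 < a by lra.
  have := pnorm_uniform_convexity (2^-1 *: (x + y)) (2^-1 *: (x - y)) a12.
  rewrite (_ : _ + 2^-1 *: (x - y) = x); last first.
    by apply/rowP => j; rewrite !mxE; field.
  rewrite (_ : _ - 2^-1 *: (x - y) = y); last first.
    by apply/rowP => j; rewrite !mxE; field.
  rewrite [N a (2^-1 *: (x - y))]pnormZ// ger0_norm// exprMn.
  move: (N a _ ^+ 2) (N a _ ^+ 2) (N a _ ^+ 2) (N a _ ^+ 2) => M D X Y h.
  have i0 : 0 < (a - 1)^-1 by rewrite invr_gt0 subr_gt0.
  have iE : (a - 1)^-1 * (a - 1) = 1 by rewrite mulVf// gt_eqF// subr_gt0.
  have := ler_wpM2l (ltW i0) h.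
  rewrite mulrDr !mulrA iE; move: (a - 1)^-1 => i.
  by rewrite mulrDr; lra.
have a0 : 0 < a by lra.
have [j NE] := pnorm_ord1 n1 a0.
rewrite !NE !mxE !real_normK ?num_real//.
have i0 : 2^-1 <= (a - 1)^-1 by rewrite lef_pV2 ?posrE; lra.
move: (x 0 j) (y 0 j) (a - 1)^-1 i0 => u v i i0.
rewrite -subr_ge0 (_ : _ - _ = (i / 8 - 1 / 32) * (u - v) ^+ 2); last by field.
by rewrite mulr_ge0 ?sqr_ge0//; lra.
Qed.

(** By Hoelder's inequality the minimum is attained at a multiple of the vector
    dual to [th], that is, at the gradient at [th] of the conjugate of [dgf a]. *)
Lemma dgf_argmin a th : 1 < a ->
  exists z, forall w, dgf a z - dotp th z <= dgf a w - dotp th w.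
Proof.
move=> a1; pose q := (1 - a^-1)^-1.
have a0 : 0 < a by lra.
have ia : a^-1 < 1 by rewrite invf_lt1.
have q0 : 0 < q by rewrite invr_gt0 subr_gt0.
have aq : a^-1 + q^-1 = 1 by rewrite invrK; ring.
have [u [un thu]] := dual_vector th a0 q0 aq.
exists ((a - 1) *: u) => w.
have hw := le_trans (ler_norm _) (hoelder_dotp th w a0 q0 aq).
rewrite /dgf pnormZ// dotpZr un thu ger0_norm; last by lra.
move: (N q th) (N a w) (dotp th w) hw => B M d hw.
have b0 : 0 < a - 1 by lra.
move: (a - 1) b0 => b b0.
have -> : 1 / (2 * b) * (b * B) ^+ 2 - b * B ^+ 2 = - (b * B ^+ 2 / 2).
  by field; exact: lt0r_neq0.
rewrite lerBrDr -lerBrDl opprK; apply: le_trans hw _.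
rewrite -subr_ge0.
rewrite (_ : _ - _ = 1 / (2 * b) * (M - b * B) ^+ 2).
  by rewrite mulr_ge0 ?sqr_ge0// divr_ge0// mulr_ge0// ltW.
by field; exact: lt0r_neq0.
Qed.

Lemma derivable_dgf a x j (t : R) : 1 < a ->
  derivable (fun t : R => dgf a (t *: delta_mx 0 j + x)) t 1.
Proof.
move=> a1; have a0 : 0 < a by lra.
pose A := \sum_(i < n | i != j) `|x 0 i| `^ a.
have A0 : 0 <= A by apply: sumr_ge0 => i _; exact: powR_ge0.
rewrite (_ : (fun _ => _) = (fun t => 1 / (2 * (a - 1)) * (A + `|x 0 j + t| `^ a) `^ (2 / a))).
  exact: derivable_shifted_powsum.
apply/funext => s; congr (_ * _).
rewrite -powR_mulrn ?pnorm_ge0// pnormE -powRrM [_^-1 * _]mulrC.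
congr (_ `^ _); rewrite (bigD1 j)//= addrC; congr (_ + _).
  apply: eq_bigr => i ij.
  by rewrite !mxE eqxx (negbTE ij) mulr0 add0r.
by rewrite !mxE !eqxx mulr1 addrC.
Qed.

(** Fermat's rule, along each coordinate line. It turns an implicit mirror
    descent step into an explicit statement on the dual side. *)
Lemma gradient_dgf_argmin a th z : 1 < a ->
  (forall w, dgf a z - dotp th z <= dgf a w - dotp th w) ->
  gradient (dgf a) z = th.
Proof.
move=> a1 zmin; apply/rowP => j; rewrite mxE.
pose f := fun t : R => dgf a (t *: delta_mx 0 j + z).
have fd t : derivable f t 1 by exact: derivable_dgf.
have -> : 'D_(delta_mx 0 j) (dgf a) z = 'D_1 f 0.
  rewrite /derive; set g1 := fun h => h^-1 *: _; set g2 := fun h => h^-1 *: _.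
  suff -> : g1 = g2 by [].
  apply/funext => h; rewrite /g1 /g2.
  by rewrite /f /= addr0 scale0r add0r [_%:A]mulr1.
pose g := fun t : R => f t - t * th 0 j.
have gd t : derivable g t 1.
  apply: derivableB => //; apply: derivableM => //; exact: derivable_cst.
have : is_derive (0 : R) 1 g 0.
  apply: (@derive1_at_min _ _ (-1) 1) => //.
    by rewrite in_itv/=; lra.
  move=> t _; rewrite /g /f scale0r add0r mul0r subr0.
  have := zmin (t *: delta_mx 0 j + z).
  rewrite dotpDr dotpZr dotp_delta; lra.
case => _; rewrite /g deriveB//.
have -> : 'D_1 (fun t : R => t * th 0 j) (0 : R) = th 0 j.
  by rewrite (@deriveMr _ _ id)// derive_id mulr1.
by move/eqP; rewrite subr_eq0 => /eqP.
Qed.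
End dgf.
End generating_function.

(** * Subgradients of convex functions *)

Section convex_functions.
Context {R : realType} {n : nat}.
Implicit Types (x y g : 'rV[R]_n) (f : 'rV[R]_n -> R).

Lemma convex_functionP f :
  @convex_function R 'rV[R]_n setT f <->
  forall (t : R) x y, 0 <= t <= 1 ->
    f (t *: x + (1 - t) *: y) <= t * f x + (1 - t) * f y.
Proof.
split=> [cf t x y /andP[t0 t1]|cf t x y _ _].
  by have := cf (Itv01 t0 t1) x y; rewrite !inE/= => /(_ Logic.I Logic.I).
by apply: cf; rewrite ge0 le1.
Qed.

(** One Hahn-Banach extension step: convexity separates the slopes allowed by
    the two open half-lines in the new direction [e]. *)
Lemma affine_minorant_extend f (V : set 'rV[R]_n) x g (e : 'rV[R]_n) :
  @convex_function R 'rV[R]_n setT f ->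
  V 0 -> (forall (t : R) u v, 0 <= t <= 1 -> V u -> V v -> V (t *: u + (1 - t) *: v)) ->
  (forall v, V v -> f x + dotp g v <= f (x + v)) ->
  exists c : R, forall v (t : R), V v ->
    f x + dotp g v + c * t <= f (x + v + t *: e).
Proof.
move=> /convex_functionP cf V0 Vc gV.
pose F v t := f (x + v + t *: e) - f x - dotp g v.
have Fge0 v : V v -> 0 <= F v 0.
  by move=> Vv; have := gV v Vv; rewrite /F scale0r addr0; lra.
have key v w (s t : R) : V v -> V w -> 0 < s -> 0 < t -> - F w (- s) / s <= F v t / t.
  move=> Vv Vw s0 t0; pose l := t / (s + t).
  have st0 : 0 < s + t by rewrite addr_gt0.
  have l01 : 0 <= l <= 1.
    by apply/andP; split; [exact: divr_ge0 (ltW t0) (ltW st0)|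
      rewrite ler_pdivrMr// mul1r; lra].
  have lE : 1 - l = s / (s + t) by rewrite /l; field; rewrite gt_eqF.
  have := Fge0 _ (Vc l w v l01 Vw Vv).
  have := cf l (x + w + (- s) *: e) (x + v + t *: e) l01.
  have -> : l *: (x + w + - s *: e) + (1 - l) *: (x + v + t *: e) =
      x + (l *: w + (1 - l) *: v) + 0 *: e.
    have ls : l * s = (1 - l) * t by rewrite lE /l; field; rewrite gt_eqF.
    apply/rowP => j; rewrite !mxE.
    rewrite -(subrr (l * s)) {1}ls; ring.
  rewrite /F => h1; rewrite dotpDr !dotpZr => h2.
  have {h1 h2} h : 0 <= l * F w (- s) + (1 - l) * F v t by rewrite /F; lra.
  rewrite lE /l in h.
  have -> : F v t / t = (s / (s + t) * F v t) * ((s + t) / (s * t)).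
    by field; rewrite !gt_eqF.
  have -> : - F w (- s) / s = (- (t / (s + t) * F w (- s))) * ((s + t) / (s * t)).
    by field; rewrite !gt_eqF.
  by rewrite ler_pM2r ?divr_gt0 ?mulr_gt0//; lra.
pose A := [set r | exists w s, [/\ V w, 0 < s & r = - F w (- s) / s]].
have A0 : A !=set0 by exists (- F 0 (- 1) / 1); exists 0, 1; split.
have ubA v (t : R) : V v -> 0 < t -> ubound A (F v t / t).
  by move=> Vv t0 _ [w [s [Vw s0 ->]]]; exact: key.
have hA : has_ubound A by exists (F 0 1 / 1); exact: ubA.
exists (sup A) => v t Vv.
suff : sup A * t <= F v t by rewrite /F; lra.
have [t0|t0|->] := ltgtP t 0; last by rewrite mulr0 Fge0.
- have nt0 : 0 < - t by rewrite oppr_gt0.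
  have : A (- F v t / - t) by exists v, (- t); rewrite opprK; split.
  move/(ub_le_sup hA).
  by rewrite ler_pdivrMr// mulrN lerN2.
- by rewrite -ler_pdivlMr//; apply: ge_sup => //; exact: ubA.
Qed.

(** The affine minorant is extended one coordinate at a time, from the point [x]
    to the whole space. *)
Lemma subdifferential_neq0 f x :
  @convex_function R 'rV[R]_n setT f -> subdifferential f x !=set0.
Proof.
move=> cf.
pose V m : set 'rV[R]_n := [set v | forall j : 'I_n, (m <= j)%N -> v 0 j = 0].
suff H m : exists g, forall v, V m v -> f x + dotp g v <= f (x + v).
  have [g gV] := H n; exists g => y; have := gV (y - x).
  rewrite [x + (y - x)]addrC subrK; apply => j.
  by rewrite leqNgt ltn_ord.
elim: m => [|m [g gV]].
  exists 0 => v Vv; rewrite dotp0l addr0 (_ : v = 0) ?addr0//.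
  by apply/rowP => j; rewrite Vv// mxE.
have [nm|mn] := leqP n m.
  exists g => v Vv; apply: gV => j mj.
  by have := leq_trans nm mj; rewrite leqNgt ltn_ord.
pose j := Ordinal mn.
have [||c cP] := @affine_minorant_extend f (V m) x g (delta_mx 0 j) cf _ _ gV.
- by move=> i _; rewrite mxE.
- by move=> t u v _ Vu Vv i mi; rewrite !mxE Vu// Vv// !mulr0 addr0.
exists (g + (c - g 0 j) *: delta_mx 0 j) => v Vv.
pose w := v - v 0 j *: delta_mx 0 j.
have Vw : V m w.
  move=> i; rewrite leq_eqVlt => /orP[/eqP ji|mi].
    have -> : i = j by apply/val_inj.
    by rewrite !mxE !eqxx mulr1 subrr.
  have vi := Vv i mi.
  have ij : i != j by rewrite -val_eqE/= neq_ltn mi orbT.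
  by rewrite !mxE vi (negbTE ij) andbF mulr0 subrr.
have := cP w (v 0 j) Vw.
have -> : x + w + v 0 j *: delta_mx 0 j = x + v by rewrite /w -addrA subrK.
rewrite dotpDr dotpNr dotpZr dotp_delta dotpDl dotpZl [dotp (delta_mx 0 j) v]dotpC.
by rewrite dotp_delta; lra.
Qed.

Lemma convex_lipschitz f (B : 'rV[R]_n -> R) x y :
  @convex_function R 'rV[R]_n setT f ->
  (forall z g d, subdifferential f z g -> `|dotp g d| <= B d) ->
  f x - f y <= B (x - y).
Proof.
move=> cf fB; have [g gx] := subdifferential_neq0 x cf.
have := gx y; have := le_trans (ler_norm _) (fB x g (x - y) gx).
by rewrite !dotpDr !dotpNr; lra.
Qed.

(** The affine minorant at the mean, averaged over the points. *)
Lemma jensen_mean k f (p : 'I_k -> 'rV[R]_n) : (0 < k)%N ->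
  @convex_function R 'rV[R]_n setT f ->
  f (k%:R^-1 *: \sum_i p i) <= k%:R^-1 * \sum_i f (p i).
Proof.
move=> k0 cf; set m := _ *: _.
have [g gm] := subdifferential_neq0 m cf.
have kn0 : k%:R != 0 :> R by rewrite pnatr_eq0 -lt0n.
have : \sum_(i < k) (f m + dotp g (p i - m)) <= \sum_i f (p i).
  by apply: ler_sum => i _; exact: gm.
rewrite big_split/= sumr_const card_ord.
have -> : \sum_(i < k) dotp g (p i - m) = 0.
  under eq_bigr do rewrite dotpDr dotpNr.
  rewrite big_split/= sumr_const card_ord.
  have -> : \sum_(i < k) dotp g (p i) = k%:R * dotp g m.
    rewrite /m dotpZr mulrA mulfV// mul1r /dotp exchange_big/=.
    by apply: eq_bigr => j _; rewrite summxE mulr_sumr.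
  by rewrite mulr_natl mulNrn subrr.
by rewrite addr0 -[f m *+ k]mulr_natl mulrC -ler_pdivlMr ?ltr0n// mulrC.
Qed.
End convex_functions.

(** * Regularized leaders and mirror descent *)

Section regularized_leader.
Context {R : realType} {n : nat}.
Implicit Types (a alpha eps : R) (x y z w d th : 'rV[R]_n).
Local Notation N a := (@pnorm R n a).

Definition admissible a := (1 < a <= 2) || (n == 1%N) && (1 < a <= 3).

Lemma admissible_gt1 a : admissible a -> 1 < a.
Proof. by case/orP => [/andP[]|/andP[_ /andP[]]]. Qed.

Definition regularized a alpha (f : nat -> 'rV[R]_n -> R) i x : R :=
  alpha^-1 * dgf a x + \sum_(j < i) f j x.

(** Uniform convexity keeps two consecutive leaders within [O(alpha)] of each
    other, so that the leader loses only [O(alpha)] per round on the leader that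
    already knows the round's loss. The slack [eps] is there because a strategy
    that depends measurably on the losses only minimizes approximately. *)
Lemma regularized_leader_regret a alpha eps k (f : nat -> 'rV[R]_n -> R)
    (y : nat -> 'rV[R]_n) z :
  admissible a -> 0 < alpha ->
  (forall i u v, (i < k)%N ->
     f i (2^-1 *: (u + v)) <= (f i u + f i v) / 2) ->
  (forall i u v, (i < k)%N -> f i u - f i v <= 4 * N a (u - v)) ->
  (forall i w, (i <= k)%N ->
     regularized a alpha f i (y i) <= regularized a alpha f i w + eps) ->
  \sum_(i < k) (f i (y i) - f i z) <=
    alpha^-1 * dgf a z + eps + k%:R * (2 * eps + 64 * alpha).
Proof.
move=> adm al0 fc fl ymin; have a1 := admissible_gt1 adm.
have ial0 : 0 < alpha^-1 by rewrite invr_gt0.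
suff H m : (m <= k)%N -> \sum_(i < m) f i (y i) <=
    regularized a alpha f m (y m) + m%:R * (2 * eps + 64 * alpha).
  rewrite sumrB lerBlDr; apply: le_trans (H k (leqnn k)) _.
  have := ymin k z (leqnn k); rewrite {2}/regularized.
  by move: (k%:R * _) => K; lra.
elim: m => [_|m IH mk].
  rewrite big_ord0 mul0r addr0 /regularized big_ord0 addr0.
  by rewrite mulr_ge0 ?dgf_ge0// ltW.
rewrite big_ord_recr/= -natr1 mulrDl mul1r.
have := IH (ltnW mk).
suff : regularized a alpha f m (y m) + f m (y m) <=
    regularized a alpha f m.+1 (y m.+1) + (2 * eps + 64 * alpha).
  by move: (m%:R * _) => K; lra.
have -> : regularized a alpha f m.+1 (y m.+1) =
    regularized a alpha f m (y m.+1) + f m (y m.+1).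
  by rewrite /regularized big_ord_recr/= addrA.
set r := N a (y m - y m.+1).
have Lf : f m (y m) - f m (y m.+1) <= 4 * r by exact: fl.
have mid : regularized a alpha f m (2^-1 *: (y m + y m.+1)) <=
    (regularized a alpha f m (y m) + regularized a alpha f m (y m.+1)) / 2
    - alpha^-1 * (r ^+ 2 / 32).
  have := ler_wpM2l (ltW ial0) (dgf_midconvex (y m) (y m.+1) adm).
  have : \sum_(j < m) f j (2^-1 *: (y m + y m.+1)) <=
      (\sum_(j < m) f j (y m) + \sum_(j < m) f j (y m.+1)) / 2.
    rewrite -big_split/= mulr_suml; apply: ler_sum => j _.
    by apply: fc; exact: ltn_trans (ltn_ord j) mk.
  by rewrite /regularized -/r mulrBr mulrA mulrDr; lra.
have := ymin m (2^-1 *: (y m + y m.+1)) (ltnW mk).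
have : 4 * r - alpha^-1 * (r ^+ 2 / 16) <= 64 * alpha.
  rewrite -subr_ge0.
  have -> : 64 * alpha - (4 * r - alpha^-1 * (r ^+ 2 / 16)) =
      alpha^-1 / 16 * (r - 32 * alpha) ^+ 2.
    by field; exact: lt0r_neq0.
  by rewrite mulr_ge0 ?sqr_ge0// divr_ge0// ltW.
lra.
Qed.

Lemma dotp_lipschitz a g u v : (forall d, `|dotp g d| <= 4 * N a d) ->
  dotp g u - dotp g v <= 4 * N a (u - v).
Proof.
by move=> gB; have := le_trans (ler_norm _) (gB (u - v)); rewrite dotpDr dotpNr.
Qed.
End regularized_leader.

Section mirror_descent.
Context {R : realType} {n : nat} {d : measure_display} {T : measurableType d}.
Implicit Types (a alpha : R) (x z w : 'rV[R]_n).
Local Notation N a := (@pnorm R n a).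
Variables (gamma : 'rV[R]_n -> R) (a alpha : R) (k : nat).
Hypotheses (adm : @admissible R n a) (al0 : 0 < alpha).
Hypothesis gammaP : forall g, gamma g <= 1 -> forall v, `|dotp g v| <= 4 * N a v.
Variables (F : 'rV[R]_n -> T -> R) (s : k.-tuple T) (y g : nat -> 'rV[R]_n).
Hypothesis Fcls : loss_class gamma F.

(** The iterates are the exact regularized leaders of the linearized losses:
    the gradient of [dgf a] at each of them is [- alpha] times the sum of the
    subgradients seen so far. *)
Lemma mirror_descent_leader : mirror_descent_run (dgf a) alpha F s y g ->
  forall i w, (i <= k)%N ->
    regularized a alpha (fun j => dotp (g j)) i (y i) <=
    regularized a alpha (fun j => dotp (g j)) i w.
Proof.
move=> [y0 run]; have a1 := admissible_gt1 adm.
pose th i := - (alpha *: \sum_(j < i) g j).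
suff H i : (i <= k)%N ->
    forall w, dgf a (y i) - dotp (th i) (y i) <= dgf a w - dotp (th i) w.
  move=> i w ik; have := H i ik w.
  have regE u : regularized a alpha (fun j => dotp (g j)) i u =
      alpha^-1 * (dgf a u - dotp (th i) u).
    rewrite /regularized /th dotpNl dotpZl opprK mulrDr.
    rewrite [alpha^-1 * (alpha * _)]mulrA mulVf ?gt_eqF//.
    rewrite mul1r; congr (_ + _); rewrite /dotp exchange_big/=.
    by apply: eq_bigr => l _; rewrite summxE mulr_suml.
  by rewrite !regE ler_pM2l// invr_gt0.
elim: i => [_ w|i IH ik].
  by rewrite y0 /th big_ord0 scaler0 oppr0 !dotp0l !subr0 dgf0// dgf_ge0.
have [_ ymin] := run (Ordinal ik).
have Gi := gradient_dgf_argmin a1 (IH (ltnW ik)).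
move=> w; have := ymin w; rewrite /= /bregman Gi.
have -> : th i.+1 = th i - alpha *: g i.
  by rewrite /th big_ord_recr/= scalerDr opprD.
move: (th i) => t; rewrite !dotpDl !dotpNl !dotpZl !dotpDr !dotpNr => h.
have := ler_wpM2l (ltW al0) h.
rewrite ![alpha * (_ + _)]mulrDr ![alpha * (alpha^-1 * _)]mulrA.
by rewrite mulfV ?gt_eqF// !mul1r; lra.
Qed.

Hypothesis run : mirror_descent_run (dgf a) alpha F s y g.

Lemma run_subgradient (i : 'I_k) v : `|dotp (g i) v| <= 4 * N a v.
Proof.
have [_ /(_ i)[gi _]] := run; apply: gammaP.
by have [_ _] := Fcls; apply; exact: gi.
Qed.

Lemma run_regret_le x : average_regret F s (fun i => y i) x <=
  k%:R^-1 * \sum_(i < k) (dotp (g i) (y i) - dotp (g i) x).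
Proof.
rewrite /average_regret ler_wpM2l// ler_sum// => i _.
have [_ /(_ i)[gi _]] := run; have := gi x.
by rewrite dotpDr dotpNr; lra.
Qed.

Lemma mirror_descent_regret x : (0 < k)%N -> N a x <= 1 ->
  average_regret F s (fun i => y i) x <=
    (2 * (a - 1) * alpha * k%:R)^-1 + 64 * alpha.
Proof.
move=> k0 x1; apply: le_trans (run_regret_le x) _.
have a1 := admissible_gt1 adm.
have kp : 0 < k%:R :> R by rewrite ltr0n.
rewrite ler_pdivrMl//.
apply: le_trans (@regularized_leader_regret _ _ a alpha 0 k
    (fun j => dotp (g j)) y x adm al0 _ _ _) _.
- by move=> i u v _; rewrite dotpZr dotpDr mulrC.
- move=> i u v ik; apply: dotp_lipschitz.
  exact: (run_subgradient (Ordinal ik)).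
- by move=> i w ik; rewrite addr0; exact: mirror_descent_leader.
rewrite addr0 mulr0 add0r mulrDr lerD2r.
have hx : dgf a x <= 1 / (2 * (a - 1)).
  rewrite /dgf -[leRHS]mulr1 ler_wpM2l//.
    by rewrite divr_ge0// mulr_ge0// subr_ge0 ltW.
  by rewrite -(expr1n _ 2) ler_pXn2r ?nnegrE ?pnorm_ge0.
apply: le_trans (ler_wpM2l _ hx) _; first by rewrite invr_ge0 ltW.
rewrite le_eqVlt; apply/orP; left; apply/eqP; field.
by rewrite !gt_eqF// subr_gt0.
Qed.

(** When [k (a - 1) <= 1] the regularizer grows quadratically with a coefficient
    of at least [k / 2], and the [k] losses grow linearly with slope at most
    [4 k]: the iterates stay in a ball of constant radius. *)
Lemma mirror_descent_regret_short x : (0 < k)%N -> alpha = 1 ->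
  k%:R * (a - 1) <= 1 -> N a x <= 1 ->
  average_regret F s (fun i => y i) x <= 36.
Proof.
move=> k0 al1 ka x1; apply: le_trans (run_regret_le x) _.
have a1 := admissible_gt1 adm.
have kp : 0 < k%:R :> R by rewrite ltr0n.
have yB (i : 'I_k) : N a (y i) <= 8.
  have := mirror_descent_leader run 0 (ltnW (ltn_ord i)).
  rewrite /regularized dgf0// mulr0 add0r [X in _ <= X]big1; last first.
    by move=> j _; rewrite dotp0r.
  rewrite al1 invr1 mul1r => h.
  have : - \sum_(j < i) dotp (g j) (y i) <= k%:R * (4 * N a (y i)).
    apply: le_trans (ler_norm _) _; rewrite normrN.
    apply: le_trans (ler_norm_sum _ _ _) _.
    apply: (@le_trans _ _ (\sum_(j < i) 4 * N a (y i))).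
      apply: ler_sum => j _.
      exact: (run_subgradient (widen_ord (ltnW (ltn_ord i)) j)).
    rewrite sumr_const card_ord -[_ *+ i]mulr_natl ler_wpM2r//.
      by rewrite mulr_ge0// pnorm_ge0.
    by rewrite ler_nat ltnW.
  rewrite /dgf in h; have := pnorm_ge0 a (y i).
  move: (N a _) h => r h r0 h2; rewrite leNgt; apply/negP => r8.
  have ap : 0 < a - 1 by rewrite subr_gt0.
  have : 1 / (2 * (a - 1)) * r ^+ 2 <= k%:R * (4 * r) by lra.
  rewrite div1r ler_pdivrMl ?mulr_gt0//.
  have : k%:R * (a - 1) * (8 * r) <= 1 * (8 * r) by rewrite ler_wpM2r// mulr_ge0.
  by nra.
rewrite ler_pdivrMl//.
apply: (@le_trans _ _ (\sum_(i < k) 36)); last first.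
  by rewrite sumr_const card_ord mulr_natl.
apply: ler_sum => i _.
have := le_trans (ler_norm _) (run_subgradient i (y i)).
have := run_subgradient i x; rewrite ler_norml => /andP[+ _].
by have := yB i; lra.
Qed.

End mirror_descent.

Section mirror_descent_rate.
Context {R : realType} {n : nat}.
Implicit Types (a : R) (gamma : 'rV[R]_n -> R) (X : set 'rV[R]_n).
Local Notation N a := (@pnorm R n a).

(** Subgradients exist by convexity, and the objective of a step is [dgf a] minus
    a linear form, which attains its minimum. *)
Lemma mirror_descent_exists gamma a (alpha : R) k : 1 < a -> 0 < alpha ->
  mirror_descent_defined (dgf a) alpha k gamma.
Proof.
move=> a1 al0 d T F s [Fc _ _].
have stepP (p : nat * 'rV[R]_n) : exists q : 'rV[R]_n * 'rV[R]_n,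
    forall ik : (p.1 < k)%N,
    subdifferential (fun x => F x (tnth s (Ordinal ik))) p.2 q.1 /\
    forall z, dotp q.1 q.2 + alpha^-1 * bregman (dgf a) q.2 p.2
              <= dotp q.1 z + alpha^-1 * bregman (dgf a) z p.2.
  have [ik|ik] : (p.1 < k)%N \/ ~~ (p.1 < k)%N by apply/orP; rewrite orbN.
  2: by exists (0, 0) => ik'; rewrite ik' in ik.
  have [g gp] := subdifferential_neq0 p.2 (Fc (tnth s (Ordinal ik))).
  have [z zmin] := dgf_argmin (gradient (dgf a) p.2 - alpha *: g) a1.
  exists (g, z) => ik'; rewrite (bool_irrelevance ik' ik); split => //= w.
  have := zmin w; rewrite /bregman.
  move: (gradient _ _) => t; rewrite !dotpDl !dotpNl !dotpZl !dotpDr !dotpNr => h.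
  rewrite -(ler_pM2l al0).
  rewrite ![alpha * (_ + _)]mulrDr ![alpha * (alpha^-1 * _)]mulrA.
  by rewrite mulfV ?gt_eqF// !mul1r; lra.
have [st stP] := choice stepP.
pose y := fix y i := if i is i'.+1 then (st (i', y i')).2 else 0.
exists y, (fun i => (st (i, y i)).1); split => // i.
have := stP (nat_of_ord i, y i) (ltn_ord i) => /=.
by rewrite (_ : Ordinal _ = i)//; exact/val_inj.
Qed.

(** The stepsize [1 / sqrt (k (a - 1))] balances the two terms of the regret. *)
Lemma mirror_descent_rate gamma X a k : @admissible R n a -> (0 < k)%N ->
  (forall g, gamma g <= 1 -> forall v, `|dotp g v| <= 4 * N a v) ->
  (forall x, X x -> N a x <= 1) ->
  mirror_descent_attains (dgf a) k X gamma
    (71 * Num.min 1 (Num.sqrt (1 / (k%:R * (a - 1))))).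
Proof.
move=> adm k0 gP XP; have a1 := admissible_gt1 adm.
have kp : 0 < k%:R :> R by rewrite ltr0n.
have bp : 0 < k%:R * (a - 1) by rewrite mulr_gt0// subr_gt0.
set r := Num.sqrt _.
have r0 : 0 < r by rewrite sqrtr_gt0 divr_gt0.
have rE : r ^+ 2 * (k%:R * (a - 1)) = 1.
  by rewrite sqr_sqrtr ?divr_ge0// ?(ltW bp)// mul1r mulVf// gt_eqF.
have [ka|ka] := leP (k%:R * (a - 1)) 1.
  exists 1; split => //; first exact: mirror_descent_exists.
  apply: ge_ereal_sup => _ [d [T [F [s [y [g [x [Fc run Xx ->]]]]]]]].
  rewrite lee_fin.
  apply: le_trans (mirror_descent_regret_short adm ltr01 gP Fc run k0 erefl ka (XP _ Xx)) _.
  rewrite min_l; first by lra.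
  by rewrite -(@ler_pXn2r _ 2) ?nnegrE ?(ltW r0)// expr1n; nra.
exists r; split => //; first exact: mirror_descent_exists.
apply: ge_ereal_sup => _ [d [T [F [s [y [g [x [Fc run Xx ->]]]]]]]].
rewrite lee_fin.
apply: le_trans (mirror_descent_regret adm r0 gP Fc run k0 (XP _ Xx)) _.
rewrite min_r; last by rewrite -(@ler_pXn2r _ 2) ?nnegrE ?(ltW r0)// expr1n; nra.
suff -> : (2 * (a - 1) * r * k%:R)^-1 = r / 2 by lra.
by apply: mulr1_eq; rewrite -[RHS]rE; field.
Qed.
End mirror_descent_rate.

(** * A measurable strategy with small regret *)

Arguments measurable_rule {R n d} T.
Arguments worst_regret {R n d} T.
Arguments worst_excess_risk {R n d} T.

Section rational_points.
Context {R : realType} {n : nat}.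
Implicit Types (x y z : 'rV[R]_n) (a eta : R).
Local Notation N a := (@pnorm R n a).

Definition rat_point (l : nat) : 'rV[R]_n :=
  if unpickle l is Some q then map_mx ratr (q : 'rV[rat]_n) else 0.

(** Rounding towards 0 does not increase the absolute value of any coordinate,
    hence no [l_a] norm: the approximation does not increase the regularizer. *)
Lemma rat_point_dense z eta : 0 < eta -> exists l, forall j,
  `|rat_point l 0 j| <= `|z 0 j| /\ `|rat_point l 0 j - z 0 j| <= eta.
Proof.
move=> eta0.
have pos (t : R) : 0 < t -> exists q : rat, 0 <= (ratr q : R) <= t /\ t - eta <= ratr q.
  move=> t0; have [q] : exists q, ratr q \in `]Num.max 0 (t - eta), t[.
    by apply: rat_in_itvoo; rewrite gt_max t0 ltrBlDr ltrDl.
  rewrite in_itv/= gt_max => /andP[/andP[q0 q1] q2].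
  by exists q; split; [apply/andP; split|]; exact: ltW.
have rnd (t : R) : exists q : rat, `|ratr q : R| <= `|t| /\ `|ratr q - t| <= eta.
  have [t0|t0|->] := ltgtP t 0.
  - have [|q [/andP[q0 q1] q2]] := pos (- t); first by rewrite oppr_gt0.
    exists (- q); rewrite rmorphN/=; move: (ratr q) q0 q1 q2 => r r0 r1 r2.
    by split; [rewrite normrN|]; rewrite ger0_norm ?(ltr0_norm t0)//; lra.
  - have [q [/andP[q0 q1] q2]] := pos t t0.
    exists q; move: (ratr q) q0 q1 q2 => r r0 r1 r2.
    by split; [|rewrite distrC]; rewrite ger0_norm ?(gtr0_norm t0)//; lra.
  - by exists 0; rewrite rmorph0 subr0 normr0; split => //; exact: ltW.
have [q qP] := choice (fun j : 'I_n => rnd (z 0 j)).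
exists (pickle (\row_j q j)) => j.
by rewrite /rat_point pickleK mxE mxE; exact: qP.
Qed.

Lemma le_pnorm a x y : 0 < a -> (forall j, `|x 0 j| <= `|y 0 j|) -> N a x <= N a y.
Proof.
move=> a0 xy; rewrite !pnormE; apply: ge0_ler_powR.
- by rewrite invr_ge0 ltW.
- by rewrite nnegrE powsum_ge0.
- by rewrite nnegrE powsum_ge0.
apply: ler_sum => j _; apply: ge0_ler_powR => //.
by rewrite ltW.
Qed.

Lemma rat_point_pnorm_dense a z eta : 0 < a -> 0 < eta ->
  exists l, N a (rat_point l) <= N a z /\ N a (rat_point l - z) <= eta.
Proof.
move=> a0 eta0; pose e : 'rV[R]_n := const_mx 1.
have c0 : 0 < N a e + 1 by rewrite ltr_wpDl// pnorm_ge0.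
have [|l lP] := rat_point_dense z (eta := eta / (N a e + 1)).
  by rewrite divr_gt0.
exists l; split; first by apply: le_pnorm => // j; have [] := lP j.
apply: (@le_trans _ _ (N a ((eta / (N a e + 1)) *: e))).
  apply: le_pnorm => // j; have [_] := lP j; rewrite !mxE mulr1 => /le_trans; apply.
  by rewrite ler_norm.
rewrite pnormZ// ger0_norm; last by rewrite divr_ge0 ?(ltW eta0) ?(ltW c0).
by rewrite mulrAC ler_pdivrMr// ler_wpM2l ?(ltW eta0)// lerDl.
Qed.
End rational_points.

Lemma measurable_fun_nat_index d (T : measurableType d) (P : nat -> set T)
    (I : T -> nat) :
  (forall l, measurable (P l)) -> (forall t, P (I t) t) ->
  (forall t l, P l t -> (I t <= l)%N) -> measurable_fun [set: T] I.
Proof.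
move=> mP PI Imin _ B _; rewrite setTI.
rewrite (_ : I @^-1` B = \bigcup_(l in B) (P l `\` \bigcup_(m in [set m | (m < l)%N]) P m)).
  apply: bigcup_measurable => l _; apply: measurableD => //.
  exact: bigcup_measurable.
apply/seteqP; split => [t Bt|t [l Bl [Pl nP]]] /=.
  exists (I t) => //; split => // -[m /= mI] /Imin.
  by rewrite leqNgt mI.
suff -> : I t = l by [].
apply/eqP; rewrite eqn_leq Imin//= leqNgt; apply/negP => It.
by apply: nP; exists (I t).
Qed.

Section approximate_leader.
Context {R : realType} {n : nat}.
Implicit Types (a alpha eps : R) (z : 'rV[R]_n) (u : seq ('rV[R]_n -> R)).
Local Notation N a := (@pnorm R n a).

Definition leader_obj a alpha u z : R := alpha^-1 * dgf a z + \sum_(f <- u) f z.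

Definition near_leader a alpha eps u l : Prop := forall m,
  leader_obj a alpha u (rat_point l) <= leader_obj a alpha u (rat_point m) + eps.

(** The first near-optimal rational point: a search through a countable family
    of measurable conditions is measurable. *)
Definition leader_index a alpha eps u : nat :=
  if pselect (exists l, `[< near_leader a alpha eps u l >]) is left exl
  then ex_minn exl else 0%N.

Definition approx_leader a alpha eps u := @rat_point R n (leader_index a alpha eps u).

(** The objective is bounded below, because the quadratic growth of the
    regularizer beats the linear decrease of Lipschitz losses. *)
Lemma near_leader_exists a alpha eps u : 1 < a -> 0 < alpha -> 0 < eps ->
  (forall f, List.In f u -> forall x y, f x - f y <= 4 * N a (x - y)) ->
  exists l, near_leader a alpha eps u l.
Proof.
move=> a1 al0 e0 uL; have a0 : 0 < a by lra.
pose A := range (fun l => leader_obj a alpha u (rat_point l)).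
have uB z : \sum_(f <- u) f 0 - (size u)%:R * (4 * N a z) <= \sum_(f <- u) f z.
  elim: u uL {A} => [|f u IH] uL; first by rewrite !big_nil mul0r subr0.
  rewrite !big_cons/= -natr1 mulrDl mul1r.
  have := uL f (or_introl erefl) 0 z; rewrite sub0r pnormN//.
  have := IH (fun g gu => uL g (or_intror gu)).
  by move: (_ * (4 * _)) => K; lra.
pose c := alpha^-1 * (1 / (2 * (a - 1))).
have c0 : 0 < c by rewrite mulr_gt0 ?invr_gt0// divr_gt0// mulr_gt0// subr_gt0.
have lbA : has_lbound A.
  exists (\sum_(f <- u) f 0 - (4 * (size u)%:R) ^+ 2 / (4 * c)) => _ [l _ <-].
  rewrite /leader_obj /dgf mulrA -/c; have := uB (rat_point l).
  move: (N a _) (size u)%:R => r s.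
  suff : 0 <= c * r ^+ 2 - s * (4 * r) + (4 * s) ^+ 2 / (4 * c) by lra.
  rewrite (_ : _ + _ = c * (r - 2 * s / c) ^+ 2).
    by rewrite mulr_ge0 ?sqr_ge0// ltW.
  by field; rewrite gt_eqF.
have hA : has_inf A by split => //; exists (leader_obj a alpha u (rat_point 0)), 0%N.
have [_ [l _ <-] lE] := inf_adherent e0 hA.
exists l => m; apply: le_trans (ltW lE) _; rewrite lerD2r.
by apply: ge_inf => //; exists m.
Qed.

Lemma leader_indexP a alpha eps u : (exists l, near_leader a alpha eps u l) ->
  near_leader a alpha eps u (leader_index a alpha eps u) /\
  forall l, near_leader a alpha eps u l -> (leader_index a alpha eps u <= l)%N.
Proof.
move=> [l0 l0P]; rewrite /leader_index; case: pselect => [exl|]; last first.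
  by case; exists l0; exact/asboolP.
case: ex_minnP => l /asboolP lP lmin; split=> // m mP.
by apply: lmin; exact/asboolP.
Qed.

Lemma approx_leader_near a alpha eps u z : 1 < a -> 0 < alpha -> 0 < eps ->
  (forall f, List.In f u -> forall x y, f x - f y <= 4 * N a (x - y)) ->
  leader_obj a alpha u (approx_leader a alpha eps u) <=
  leader_obj a alpha u z + 2 * eps.
Proof.
move=> a1 al0 e0 uL; have a0 : 0 < a by lra.
have [H _] := leader_indexP (near_leader_exists a1 al0 e0 uL).
pose s : R := (size u)%:R + 1.
have s0 : 0 < s by rewrite ltr_wpDl.
have [|l [lz lE]] := rat_point_pnorm_dense z (eta := eps / (4 * s)) a0.
  by rewrite divr_gt0// mulr_gt0.
apply: le_trans (H l) _.
suff : leader_obj a alpha u (rat_point l) <= leader_obj a alpha u z + eps by lra.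
rewrite /leader_obj -addrA; apply: lerD.
  rewrite ler_wpM2l ?invr_ge0 ?(ltW al0)// /dgf ler_wpM2l//.
    by rewrite divr_ge0// mulr_ge0// subr_ge0 ltW.
  by rewrite ler_pXn2r ?nnegrE ?pnorm_ge0.
apply: (@le_trans _ _ (\sum_(f <- u) f z + (size u)%:R * (eps / s))).
  have h4 : 4 * N a (rat_point l - z) <= eps / s.
    apply: le_trans (ler_wpM2l _ lE) _ => //.
    by rewrite le_eqVlt; apply/orP; left; apply/eqP; field; rewrite gt_eqF.
  move: (eps / s) h4 => K0 h4; clear H s s0 lE.
  elim: u uL => [|f u IH] uL.
    by rewrite !big_nil mul0r addr0.
  rewrite !big_cons/= -natr1 mulrDl mul1r.
  have := uL f (or_introl erefl) (rat_point l) z.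
  have := IH (fun g gu => uL g (or_intror gu)).
  by move: (_ * K0) => K; lra.
rewrite lerD2l mulrCA -[leRHS]mulr1 ler_wpM2l ?(ltW e0)//.
by rewrite ler_pdivrMr// mul1r lerDl.
Qed.
End approximate_leader.

Section regret_rate.
Context {R : realType} {n : nat}.
Implicit Types (a alpha eps : R) (gamma : 'rV[R]_n -> R) (X : set 'rV[R]_n).
Local Notation N a := (@pnorm R n a).

Lemma loss_class_lipschitz d (T : measurableType d) gamma a
    (F : 'rV[R]_n -> T -> R) t u v :
  (forall g, gamma g <= 1 -> forall v, `|dotp g v| <= 4 * N a v) ->
  loss_class gamma F -> F u t - F v t <= 4 * N a (u - v).
Proof.
move=> gP [Fc _ FG].
apply: (@convex_lipschitz _ _ (F ^~ t) (fun w => 4 * N a w) u v (Fc t)).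
by move=> z g w /FG /gP.
Qed.

Lemma mem_observed d (T : measurableType d) (F : 'rV[R]_n -> T -> R) s f :
  List.In f (observed F s) -> exists t, f = F ^~ t.
Proof.
by elim: s => //= t s IH [<-|/IH //]; exists t.
Qed.

Lemma measurable_leader_obj d (T : measurableType d) gamma a alpha k
    (F : 'rV[R]_n -> T -> R) z : loss_class gamma F ->
  measurable_fun [set: k.-tuple T] (fun s => leader_obj a alpha (observed F s) z).
Proof.
move=> [_ mF _].
rewrite (_ : (fun _ => _) = fun s : k.-tuple T =>
    alpha^-1 * dgf a z + \sum_(i < k) F z (tnth s i)); last first.
  by apply/funext => s; rewrite /leader_obj /observed big_map big_tuple.
apply: measurable_funD; first exact: measurable_cst.
apply: measurable_sum => i; apply: measurableT_comp; first exact: mF.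
exact: measurable_tnth.
Qed.

Lemma measurable_approx_leader d (T : measurableType d) gamma a alpha eps k :
  1 < a -> 0 < alpha -> 0 < eps ->
  (forall g, gamma g <= 1 -> forall v, `|dotp g v| <= 4 * N a v) ->
  measurable_rule T gamma k (approx_leader a alpha eps).
Proof.
move=> a1 al0 e0 gP F Fc j.
have obsL (s : seq T) : exists l, near_leader a alpha eps (observed F s) l.
  apply: near_leader_exists => // f /mem_observed[t ->] x y.
  exact: loss_class_lipschitz gP Fc.
pose P l := [set s : k.-tuple T | near_leader a alpha eps (observed F s) l].
apply: (@measurableT_comp _ _ _ _ _ _ (fun l => (@rat_point R n l) 0 j) _
  (fun s : k.-tuple T => leader_index a alpha eps (observed F s))) => //.
apply: (@measurable_fun_nat_index _ _ P).
- move=> l; rewrite (_ : P l = \bigcap_m [set s : k.-tuple T |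
      leader_obj a alpha (observed F s) (rat_point l) <=
      leader_obj a alpha (observed F s) (rat_point m) + eps]); last first.
    by apply/seteqP; split => [s sP m _|s sP m]; exact: sP.
  apply: bigcap_measurable => // m _; rewrite -[X in measurable X]setTI.
  apply: measurable_fun_le => //; first exact: measurable_leader_obj Fc.
  apply: measurable_funD => //; exact: measurable_leader_obj Fc.
- by move=> s; have [] := leader_indexP (obsL s).
- by move=> s l; have [_] := leader_indexP (obsL s); apply.
Qed.

(** Mirror descent depends on a choice of subgradients, which need not be
    measurable in the samples; approximate leaders have a regret of the same
    order. When [k (a - 1) <= 1] the target is a constant and playing 0 is
    enough. *)
Lemma minimax_regret_rate gamma X a k : @admissible R n a -> (0 < k)%N ->
  (forall g, gamma g <= 1 -> forall v, `|dotp g v| <= 4 * N a v) ->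
  (forall x, X x -> N a x <= 1) ->
  (minimax_regret k X gamma <=
    (71 * Num.min 1 (Num.sqrt (1 / (k%:R * (a - 1)))))%:E)%E.
Proof.
move=> adm k0 gP XP; have a1 := admissible_gt1 adm.
have kp : 0 < k%:R :> R by rewrite ltr0n.
have bp : 0 < k%:R * (a - 1) by rewrite mulr_gt0// subr_gt0.
set r := Num.sqrt _.
have r0 : 0 < r by rewrite sqrtr_gt0 divr_gt0.
have rE : r ^+ 2 * (k%:R * (a - 1)) = 1.
  by rewrite sqr_sqrtr ?divr_ge0// ?(ltW bp)// mul1r mulVf// gt_eqF.
apply: ge_ereal_sup => _ [d [T ->]].
have [ka|ka] := leP (k%:R * (a - 1)) 1.
  apply: ge_ereal_inf; exists (worst_regret T X gamma k (fun=> 0)).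
    by exists (fun=> 0) => // i _ F _ j; exact: measurable_cst.
  apply: ge_ereal_sup => _ [F [s [x [Fc Xx ->]]]]; rewrite lee_fin.
  rewrite min_l; last first.
    by rewrite -(@ler_pXn2r _ 2) ?nnegrE ?(ltW r0)// expr1n; nra.
  rewrite /average_regret /strategy_plays ler_pdivrMl//.
  apply: (@le_trans _ _ (\sum_(i < k) 4)); last first.
    by rewrite sumr_const card_ord -[_ *+ k]mulr_natl; nra.
  apply: ler_sum => i _; apply: le_trans (loss_class_lipschitz _ _ _ gP Fc) _.
  have := XP x Xx; rewrite sub0r pnormN; lra.
apply: ge_ereal_inf; exists (worst_regret T X gamma k (approx_leader a r r)).
  by exists (approx_leader a r r) => // i _; exact: measurable_approx_leader gP.
apply: ge_ereal_sup => _ [F [s [x [Fc Xx ->]]]]; rewrite lee_fin.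
rewrite min_r; last by rewrite -(@ler_pXn2r _ 2) ?nnegrE ?(ltW r0)// expr1n; nra.
have [cF _ _] := Fc.
pose t0 := tnth s (Ordinal k0).
pose f j := F ^~ (nth t0 s j).
pose y i := approx_leader a r r (observed F (take i s)).
have regE i w : (i <= k)%N ->
    regularized a r f i w = leader_obj a r (observed F (take i s)) w.
  move=> ik; rewrite /regularized /leader_obj /observed big_map; congr (_ + _).
  rewrite (big_nth t0) size_takel ?size_tuple// big_mkord.
  by apply: eq_bigr => j _; rewrite nth_take.
rewrite /average_regret ler_pdivrMl//.
have -> : \sum_(i < k) (F (strategy_plays (approx_leader a r r) F s i) (tnth s i) -
    F x (tnth s i)) = \sum_(i < k) (f i (y i) - f i x).
  by apply: eq_bigr => i _; rewrite /f !(tnth_nth t0).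
apply: le_trans (@regularized_leader_regret _ _ a r (2 * r) k f y x adm r0 _ _ _) _.
- move=> i u v _; have /convex_functionP/(_ 2^-1 u v) := cF (nth t0 s i).
  rewrite (_ : 1 - 2^-1 = 2^-1 :> R); last by field.
  rewrite -scalerDr /f => h; apply: le_trans (h _) _; first by lra.
  by rewrite -mulrDr mulrC.
- by move=> i u v _; exact: loss_class_lipschitz gP Fc.
- move=> i w ik; rewrite !regE//; apply: approx_leader_near => //.
  by move=> g /mem_observed[t ->] u v; exact: loss_class_lipschitz gP Fc.
have hx : dgf a x <= 1 / (2 * (a - 1)).
  rewrite /dgf -[leRHS]mulr1 ler_wpM2l//.
    by rewrite divr_ge0// mulr_ge0// subr_ge0 ltW.
  by rewrite -(expr1n _ 2) ler_pXn2r ?nnegrE ?pnorm_ge0// XP.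
have h1 : r^-1 * dgf a x <= k%:R * (r / 2).
  apply: le_trans (ler_wpM2l _ hx) _; first by rewrite invr_ge0 ltW.
  rewrite le_eqVlt; apply/orP; left; apply/eqP.
  by rewrite div1r -invfM; apply: mulr1_eq; rewrite -[RHS]rE; field.
have k1 : 1 <= k%:R :> R by rewrite ler1n.
have : 2 * r <= k%:R * (2 * r) by rewrite ler_peMl// mulr_ge0// ltW.
nra.
Qed.
End regret_rate.

(** * Integration over i.i.d. samples *)

Section iid_integral.
Context {d : measure_display} {T : measurableType d} {R : realType}.
Variable P : probability T R.
Local Open Scope ereal_scope.

Lemma iid_law_integralS k (Z : k.+1.-tuple T -> \bar R) :
  measurable_fun [set: k.+1.-tuple T] Z -> (forall s, 0 <= Z s) ->
  \int[iid_law P k.+1]_s Z s =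
  \int[P]_x \int[iid_law P k]_s Z [tuple of x :: s].
Proof.
move=> mZ Z0; rewrite [LHS]ge0_integral_distribution//.
rewrite fubini_tonelli1//; last by move=> x; exact: Z0.
by apply: measurableT_comp => //; exact: measurable_tuple_cons.
Qed.

Lemma integral_prob_cst d' (S : measurableType d') (Q : probability S R)
  (c : \bar R) : \int[Q]_s c = c.
Proof.
transitivity (c * Q [set: S]); first exact: integral_cst.
by rewrite probability_setT mule1.
Qed.

Definition tuple_take i k (ik : (i <= k)%N) (s : k.-tuple T) : i.-tuple T :=
  [tuple tnth s (widen_ord ik j) | j < i].

Lemma tuple_takeE i k (ik : (i <= k)%N) (s : k.-tuple T) :
  tuple_take ik s = take i s :> seq T.
Proof.
case: i ik => [|i] ik; first by rewrite take0; exact: (congr1 val (tuple0 _)).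
pose x0 : T := tnth s (Ordinal ik).
apply: (@eq_from_nth _ x0); first by rewrite size_tuple size_takel ?size_tuple.
move=> j; rewrite size_tuple => ji.
rewrite nth_take// -[j]/(nat_of_ord (Ordinal ji)) -tnth_nth tnth_mktuple.
by rewrite (tnth_nth x0).
Qed.

Lemma measurable_tuple_take i k (ik : (i <= k)%N) :
  measurable_fun [set: k.-tuple T] (tuple_take ik).
Proof.
apply/measurable_fun_tnthP => j.
rewrite (_ : _ \o _ = (@tnth k T)^~ (widen_ord ik j)); first exact: measurable_tnth.
by apply/funext => s /=; rewrite tnth_mktuple.
Qed.

(** Independence of the [i]-th sample from the previous ones. The function [H]
    takes lists, so that prefixes of a sample need no casts between types of
    tuples. *)
Lemma iid_law_tower i k (ik : (i < k)%N) (H : seq T -> T -> \bar R) :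
  measurable_fun [set: i.-tuple T * T] (fun p => H p.1 p.2) ->
  (forall (s : i.-tuple T) t, 0 <= H s t) ->
  \int[iid_law P k]_s H (take i s) (tnth s (Ordinal ik)) =
  \int[iid_law P k]_s \int[P]_t H (take i s) t.
Proof.
elim: i k ik H => [|i IH] [//|k] ik H mH H0.
  have H0' t : 0 <= H [::] t by exact: (H0 [tuple] t).
  have mH' : measurable_fun [set: T] (H [::]).
    exact: (measurable_fun_pair2 [tuple] mH).
  have Ik (s : k.+1.-tuple T) : tnth s (Ordinal ik) = thead s.
    by rewrite /thead; congr tnth; exact/val_inj.
  under eq_integral do rewrite take0 Ik.
  under [RHS]eq_integral do rewrite take0.
  rewrite integral_prob_cst iid_law_integralS//; last first.
    apply: measurableT_comp => //; exact: measurable_tnth.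
  by apply: eq_integral => x _; rewrite -[RHS](integral_prob_cst (iid_law P k)).
have mcons x : measurable_fun [set: i.-tuple T * T]
    (fun p => ([tuple of x :: p.1], p.2) : i.+1.-tuple T * T).
  apply: measurable_fun_pair => //.
  by apply: measurable_cons.
have tE (s : k.+1.-tuple T) : take i.+1 s = tuple_take (ltnW ik) s.
  by rewrite tuple_takeE.
have mL : measurable_fun [set: k.+1.-tuple T]
    (fun s => H (take i.+1 s) (tnth s (Ordinal ik))).
  under eq_fun do rewrite tE.
  apply: (measurableT_comp mH (g := fun s : k.+1.-tuple T =>
    (tuple_take (ltnW ik) s, tnth s (Ordinal ik)))).
  apply: measurable_fun_pair; last exact: measurable_tnth.
  exact: measurable_tuple_take.
have mR : measurable_fun [set: k.+1.-tuple T]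
    (fun s => \int[P]_t H (take i.+1 s) t).
  under eq_fun do rewrite tE.
  apply: (measurableT_comp (f := fun s : i.+1.-tuple T => \int[P]_t H s t)).
    have F0 (p : i.+1.-tuple T * T) : 0 <= H p.1 p.2 by exact: H0.
    exact: (measurable_fun_fubini_tonelli_F (m2 := P) _ mH F0).
  exact: measurable_tuple_take.
rewrite iid_law_integralS//; last by move=> s; rewrite tE.
rewrite iid_law_integralS//; last first.
  by move=> s; rewrite tE; apply: integral_ge0 => t _.
apply: eq_integral => x _.
have := IH k ik (fun s => H (x :: s)).
set l1 := \int[_]_s _; set r1 := \int[_]_s _ => IHx.
transitivity l1; last first.
  rewrite IHx//; exact: (measurableT_comp mH (mcons x)).
apply: eq_integral => s _ /=; congr (H _ _).
by rewrite !(tnth_nth x).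
Qed.
End iid_integral.

Section caratheodory.
Context {R : realType} {n : nat}.
Implicit Types (u v : 'rV[R]_n).

Definition norm1 u : R := \sum_(j < n) `|u 0 j|.

Lemma norm1_ge0 u : 0 <= norm1 u.
Proof. by apply: sumr_ge0 => j _; exact: normr_ge0. Qed.

Lemma norm1D u v : norm1 (u + v) <= norm1 u + norm1 v.
Proof.
by rewrite /norm1 -big_split/=; apply: ler_sum => j _; rewrite mxE ler_normD.
Qed.

Lemma norm1N u : norm1 (- u) = norm1 u.
Proof. by apply: eq_bigr => j _; rewrite mxE normrN. Qed.

Lemma norm1Z (c : R) u : norm1 (c *: u) = `|c| * norm1 u.
Proof. by rewrite /norm1 mulr_sumr; apply: eq_bigr => j _; rewrite mxE normrM. Qed.

Lemma norm1_sum k (p : 'I_k -> 'rV[R]_n) :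
  norm1 (\sum_i p i) <= \sum_i norm1 (p i).
Proof.
elim/big_rec2: _ => [|i a b _ h]; last exact: le_trans (norm1D _ _) (lerD _ h).
by rewrite /norm1 big1// => j _; rewrite mxE normr0.
Qed.

(** A Lipschitz function of [u] is the infimum over rational points [q] of its
    value at [q] plus the distance from [u] to [q]; each of these is measurable
    in the two arguments jointly. *)
Lemma measurable_caratheodory d' (S : measurableType d') d (T : measurableType d)
    (G : 'rV[R]_n -> T -> R) (psi : S -> 'rV[R]_n) (phi : S -> T) :
  (forall u v t, G u t - G v t <= norm1 (u - v)) ->
  (forall u, measurable_fun [set: T] (G u)) ->
  measurable_vec psi -> measurable_fun [set: S] phi ->
  measurable_fun [set: S] (fun w => G (psi w) (phi w)).
Proof.
move=> GL mG mpsi mphi.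
apply: (measurability _ (RGenInftyO.measurableE R)) => //.
move=> _ [_ [c ->] <-]; rewrite setTI.
rewrite (_ : _ @^-1` _ = \bigcup_l [set w |
    G (rat_point l) (phi w) + norm1 (psi w - rat_point l) < c]); last first.
  apply/seteqP; split => [w|w [l _]] /=; rewrite in_itv/=; last first.
    by have := GL (psi w) (rat_point l) (phi w); lra.
  move=> Gc; pose e := (c - G (psi w) (phi w)) / (4 * (n%:R + 1)).
  have n0 : 0 < n%:R + 1 :> R by rewrite ltr_wpDl.
  have e0 : 0 < e by rewrite divr_gt0 ?subr_gt0// mulr_gt0.
  have [l lP] := rat_point_dense (psi w) e0.
  exists l => //=; have h : norm1 (psi w - rat_point l) <= n%:R * e.
    apply: (@le_trans _ _ (\sum_(j < n) e)).
      by apply: ler_sum => j _; rewrite !mxE distrC; have [] := lP j.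
    by rewrite sumr_const card_ord mulr_natl.
  have h2 : (n%:R + 1) * e = (c - G (psi w) (phi w)) / 4.
    by rewrite /e; field; rewrite gt_eqF.
  have := GL (rat_point l) (psi w) (phi w); rewrite -norm1N opprB.
  by rewrite mulrDl mul1r in h2; lra.
apply: bigcup_measurable => l _.
rewrite -[X in measurable X]setTI.
rewrite (_ : [set w | _] = (fun w => G (rat_point l) (phi w) +
    norm1 (psi w - rat_point l)) @^-1` `]-oo, c[%classic); last first.
  by apply/seteqP; split => w /=; rewrite in_itv.
suff H : measurable_fun [set: S] (fun w => G (rat_point l) (phi w) +
    norm1 (psi w - rat_point l)) by apply: H => //; exact: measurable_itv.
apply: measurable_funD; first exact: measurableT_comp.
rewrite (_ : (fun _ => _) = fun w => \sum_(j < n) `|psi w 0 j - rat_point l 0 j|).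
  apply: measurable_sum => j; apply: measurableT_comp => //.
  by apply: measurable_funB => //; exact: mpsi.
by apply/funext => w; apply: eq_bigr => j _; rewrite !mxE.
Qed.
End caratheodory.

(** * From regret to stochastic risk *)

Section linear_losses.
Context {R : realType} {n : nat}.
Implicit Types (u v x g : 'rV[R]_n).

Lemma convex_dotp v : @convex_function R 'rV[R]_n setT (dotp v).
Proof.
by apply/convex_functionP => t x y _; rewrite dotpDr !dotpZr.
Qed.

Lemma subdifferential_dotp v x g : subdifferential (dotp v) x g -> g = v.
Proof.
move=> gx; apply/rowP => j; apply/eqP; rewrite eq_le; apply/andP; split.
  have := gx (x + delta_mx 0 j); rewrite [x + _ - x]addrC addKr.
  by rewrite dotpDr !dotp_delta; lra.
have := gx (x - delta_mx 0 j); rewrite [x - _ - x]addrC addKr.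
by rewrite dotpDr !dotpNr !dotp_delta; lra.
Qed.
End linear_losses.

Section online_to_batch.
Context {R : realType} {n : nat}.
Implicit Types (u v x g : 'rV[R]_n).
Variables (gamma : 'rV[R]_n -> R) (X : set 'rV[R]_n) (k : nat) (M : R).
Hypothesis gamma_coord : forall g j, gamma g <= 1 -> `|g 0 j| <= 1.
Hypothesis gamma_delta : forall j (c : R), `|c| <= 1 -> gamma (c *: delta_mx 0 j) <= 1.
Hypothesis gamma0 : gamma 0 <= 1.
Hypotheses (X0 : X 0) (XM : forall x, X x -> norm1 x <= M) (k0 : (0 < k)%N).

Lemma loss_class_norm1 d (T : measurableType d) (F : 'rV[R]_n -> T -> R) u v t :
  loss_class gamma F -> F u t - F v t <= norm1 (u - v).
Proof.
move=> [Fc _ FG].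
apply: (@convex_lipschitz _ _ (F ^~ t) norm1 u v (Fc t)).
move=> z g w /FG g1; apply: le_trans (ler_norm_sum _ _ _) _.
by apply: ler_sum => j _; rewrite normrM ler_piMl// gamma_coord.
Qed.

Section augmented.
Context {d : measure_display} {T : measurableType d}.
Variable F : 'rV[R]_n -> T -> R.
Hypothesis Fc : loss_class gamma F.

(** The sample space enlarged with labels: 0 keeps the loss, 1 replaces it with
    a linear one and any other label with the zero loss. The adversary may thus
    punish any play and then stop, so that a finite regret forces bounded
    plays. *)
Definition augmented v x (w : T * nat) : R :=
  if w.2 == 0%N then F x w.1 else if w.2 == 1%N then dotp v x else dotp 0 x.

Lemma augmented_loss_class v : gamma v <= 1 -> loss_class gamma (augmented v).
Proof.
move=> v1; have [cF mF sF] := Fc; split.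
- move=> [t [|[|b]]]; rewrite /augmented/=; first exact: cF.
  + exact: convex_dotp.
  + exact: convex_dotp.
- move=> x; rewrite /augmented.
  have mb (m : nat) : measurable_fun [set: T * nat] (fun w => w.2 == m).
    by apply: (@measurableT_comp _ _ _ _ _ _ (fun b : nat => b == m)).
  apply: measurable_fun_ifT => //; first exact: measurableT_comp.
  exact: measurable_fun_ifT.
- move=> x [t [|[|b]]] g; rewrite /augmented/=; first exact: sF.
  + by move/subdifferential_dotp => ->.
  + by move/subdifferential_dotp => ->.
Qed.

Lemma observed_augmented v (s : seq T) :
  observed (augmented v) [seq (t, 0%N) | t <- s] = observed F s.
Proof. by rewrite /observed -map_comp; apply: eq_map => t. Qed.

Variable strat : seq ('rV[R]_n -> R) -> 'rV[R]_n.

Lemma measurable_rule_augmented i :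
  measurable_rule (T * nat)%type gamma i strat ->
  measurable_vec (fun s : i.-tuple T => strat (observed F s)).
Proof.
move=> ms j.
rewrite (_ : (fun _ => _) =
    (fun s : i.-tuple (T * nat) => strat (observed (augmented 0) s) 0 j) \o
    (fun s : i.-tuple T => [tuple of map (pair^~ 0%N) s])); last first.
  by apply/funext => s /=; rewrite observed_augmented.
apply: measurableT_comp; first exact: (ms _ (augmented_loss_class gamma0) j).
apply/measurable_fun_tnthP => l.
rewrite (_ : _ \o _ = (pair^~ 0%N) \o (@tnth i T)^~ l); last first.
  by apply/funext => s; rewrite /= tnth_map.
apply: measurableT_comp; first exact: pair2_measurable.
exact: measurable_tnth.
Qed.

Lemma augmented_regret_le (w : R) :
  (worst_regret (T * nat)%type X gamma k strat <= w%:E)%E ->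
  forall v (s : k.-tuple (T * nat)) x, gamma v <= 1 -> X x ->
  average_regret (augmented v) s (strategy_plays strat (augmented v) s) x <= w.
Proof.
move=> ww v s x v1 Xx; rewrite -lee_fin; apply: le_trans ww.
apply: ereal_sup_ubound; exists (augmented v), s, x; split => //.
exact: augmented_loss_class.
Qed.

(** By induction on the number of observed samples: the earlier plays are
    bounded, so that in those rounds they gain at most a constant on the point 0,
    and a linear loss on the next play followed by zero losses makes the regret
    as large as any coordinate of that play. The bound makes all the expectations
    below finite. *)
Lemma plays_bounded (w : R) :
  (worst_regret (T * nat)%type X gamma k strat <= w%:E)%E ->
  exists2 B : R, 0 <= B & forall s : seq T, (size s < k)%N ->
    norm1 (strat (observed F s)) <= B.
Proof.
move=> ww.
suff H i : exists2 B : R, 0 <= B & forall s : seq T, (size s <= i)%N ->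
    (size s < k)%N -> norm1 (strat (observed F s)) <= B.
  by have [B B0 BP] := H k; exists B => // s sk; apply: BP => //; exact: ltnW.
elim: i => [|i [B B0 IH]].
  exists (norm1 (strat [::])); first exact: norm1_ge0.
  by case.
exists (B + n%:R * `|k%:R * w + k%:R * B|).
  by rewrite addr_ge0// mulr_ge0.
move=> s; rewrite leq_eqVlt => /orP[/eqP si sk|si sk]; last first.
  by apply: le_trans (IH s si sk) _; rewrite lerDl mulr_ge0.
set p := strat _.
suff pj j : `|p 0 j| <= `|k%:R * w + k%:R * B|.
  apply: (@le_trans _ _ (\sum_(j < n) `|k%:R * w + k%:R * B|)).
    exact: ler_sum.
  by rewrite sumr_const card_ord -[leLHS]mulr_natl lerDr.
suff pv v : gamma v <= 1 -> dotp v p <= k%:R * w + k%:R * B.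
  have cp c : `|c| <= 1 -> c * p 0 j <= k%:R * w + k%:R * B.
    by move=> /(gamma_delta j)/pv; rewrite dotpZl dotpC dotp_delta.
  apply: le_trans (ler_norm _); rewrite ler_norml.
  have := cp 1; have := cp (-1); rewrite normrN1 normr1 mul1r mulN1r.
  by move=> /(_ (lexx _)) h1 /(_ (lexx _)) h2; apply/andP; split; lra.
move=> v1.
have t0 : T by case: (s) si => //.
pose s' : k.-tuple (T * nat) := [tuple (if (l < i.+1)%N then (nth t0 s l, 0%N)
  else (t0, if l == i.+1 :> nat then 1%N else 2%N)) | l < k].
have s'E (l : 'I_k) : tnth s' l = if (l < i.+1)%N then (nth t0 s l, 0%N)
  else (t0, if l == i.+1 :> nat then 1%N else 2%N) by rewrite tnth_mktuple.
have takeE l : (l <= i.+1)%N -> take l s' = [seq (t, 0%N) | t <- take l s].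
  move=> li.
  have lk : (l < k)%N by rewrite (leq_ltn_trans li)// -si.
  apply: (@eq_from_nth _ (t0, 0%N)).
    by rewrite size_map !size_takel ?size_tuple ?si// ltnW.
  move=> m; rewrite size_takel ?size_tuple ?(ltnW lk)// => ml.
  have mk := ltn_trans ml lk.
  rewrite nth_take// (nth_map t0) ?size_takel ?si// nth_take//.
  rewrite -[m]/(nat_of_ord (Ordinal mk)) -tnth_nth s'E/=.
  by rewrite (leq_trans ml li).
have := augmented_regret_le ww s' v1 X0.
rewrite /average_regret ler_pdivrMl ?ltr0n// => /(le_trans _) H.
rewrite -lerBlDr; apply: H.
have ik : (i.+1 < k)%N by rewrite -si.
apply: (@le_trans _ _ (\sum_(l < k) ((if l == Ordinal ik then dotp v p + B else 0) - B))).
  rewrite sumrB -big_mkcond big_pred1_eq sumr_const card_ord -[B *+ k]mulr_natl.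
  by lra.
apply: ler_sum => l _; rewrite /strategy_plays s'E.
case: ltngtP => li.
- rewrite (_ : (l == _) = false); last first.
    by apply/negbTE; rewrite -val_eqE/= neq_ltn li.
  rewrite add0r takeE ?(ltnW li)// observed_augmented /augmented/=.
  have pl : norm1 (strat (observed F (take l s))) <= B.
    apply: IH; rewrite size_takel ?si ?(ltnW li)//.
  have := loss_class_norm1 0 (strat (observed F (take l s))) (nth t0 s l) Fc.
  by rewrite sub0r norm1N; lra.
- rewrite (_ : (l == _) = false); last first.
    by apply/negbTE; rewrite -val_eqE/= neq_ltn li orbT.
  by rewrite add0r /augmented/= !dotp0l; lra.
- have -> : l = Ordinal ik by exact/val_inj.
  rewrite eqxx addrK /augmented/= dotp0r subr0 takeE//.
  by rewrite observed_augmented -si take_size.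
Qed.

Definition averaged_rule (u : seq ('rV[R]_n -> R)) : 'rV[R]_n :=
  k%:R^-1 *: \sum_(i < k) strat (take i u).

Hypothesis strat_meas : forall i, (i < k)%N ->
  measurable_rule (T * nat)%type gamma i strat.

Lemma measurable_play i : (i < k)%N ->
  measurable_vec (fun s : k.-tuple T => strat (observed F (take i s))).
Proof.
move=> ik j.
rewrite (_ : (fun _ => _) = (fun s : i.-tuple T => strat (observed F s) 0 j) \o
    (tuple_take (ltnW ik))); last first.
  by apply/funext => s /=; rewrite tuple_takeE.
apply: measurableT_comp; last exact: measurable_tuple_take.
exact: (measurable_rule_augmented (strat_meas ik)).
Qed.

Lemma averaged_ruleE (s : seq T) : averaged_rule (observed F s) =
  k%:R^-1 *: \sum_(i < k) strat (observed F (take i s)).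
Proof.
by congr (_ *: _); apply: eq_bigr => i _; rewrite /observed map_take.
Qed.

Lemma measurable_averaged_rule :
  measurable_vec (fun s : k.-tuple T => averaged_rule (observed F s)).
Proof.
move=> j.
rewrite (_ : (fun _ => _) = fun s : k.-tuple T =>
    k%:R^-1 * \sum_(i < k) strat (observed F (take i s)) 0 j); last first.
  by apply/funext => s; rewrite averaged_ruleE !mxE summxE.
apply: measurable_funM => //; apply: measurable_sum => i.
exact: measurable_play.
Qed.

Lemma regret_le (w : R) (s : k.-tuple T) x : X x ->
  (worst_regret (T * nat)%type X gamma k strat <= w%:E)%E ->
  \sum_(i < k) (F (strat (observed F (take i s))) (tnth s i) - F x (tnth s i))
  <= k%:R * w.
Proof.
move=> Xx ww.
have := augmented_regret_le ww [tuple of map (pair^~ 0%N) s] gamma0 Xx.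
rewrite /average_regret ler_pdivrMl ?ltr0n//; apply: le_trans.
apply: ler_sum => i _; rewrite tnth_map /augmented/= /strategy_plays/=.
by rewrite -map_take observed_augmented.
Qed.

Variable P : probability T R.
Hypothesis Fi : forall x, P.-integrable [set: T] (EFin \o F x).

Lemma population_lossE x : (\int[P]_s (F x s)%:E)%E = (population_loss F P x)%:E.
Proof.
by rewrite /population_loss /Rintegral fineK//; exact: integrable_fin_num (Fi x).
Qed.

Lemma population_loss_norm1 u v :
  population_loss F P u - population_loss F P v <= norm1 (u - v).
Proof.
rewrite /population_loss -RintegralB//.
have ic : P.-integrable [set: T] (EFin \o cst (norm1 (u - v))).
  apply: measurable_bounded_integrable => //.
    by apply: le_lt_trans (probability_le1 P measurableT) _; rewrite ltry.
  exact: bounded_cst.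
apply: le_trans (le_Rintegral _ _ ic _) _ => //.
- exact: (integrableB measurableT (Fi u) (Fi v)).
- by move=> t _; exact: loss_class_norm1.
by rewrite /Rintegral/= integral_prob_cst.
Qed.

Lemma integral_affine d' (S : measurableType d') (Q : probability S R) (Z : S -> R)
    (a b : R) : Q.-integrable [set: S] (EFin \o Z) ->
  (\int[Q]_s (a * Z s + b)%:E = a%:E * \int[Q]_s (Z s)%:E + b%:E)%E.
Proof.
move=> iZ.
have ib : Q.-integrable [set: S] (EFin \o cst b).
  apply: measurable_bounded_integrable => //.
    by apply: le_lt_trans (probability_le1 Q measurableT) _; rewrite ltry.
  exact: bounded_cst.
have iaZ : Q.-integrable [set: S] (EFin \o (fun s => a * Z s)).
  exact: (integrableZl measurableT a iZ).
rewrite [LHS](@integralD_EFin _ _ _ Q _ measurableT (fun s => a * Z s) (cst b))//.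
congr (_ + _)%E; last exact: (integral_prob_cst Q b%:E).
exact: (integralZl measurableT iZ).
Qed.

Lemma population_loss_convex : @convex_function R 'rV[R]_n setT (population_loss F P).
Proof.
apply/convex_functionP => t x y t01.
have iZ c u : P.-integrable [set: T] (EFin \o (fun s => c * F u s)).
  exact: (integrableZl measurableT c (Fi u)).
rewrite /population_loss -!RintegralZl// -RintegralD//.
apply: le_Rintegral => //.
- exact: (integrableD measurableT (iZ t x) (iZ (1 - t) y)).
- by move=> s _; have [/(_ s)/convex_functionP H _ _] := Fc; exact: H.
Qed.

Lemma integral_shifted_loss u x (c : R) :
  (\int[P]_t (F u t - F x t + c)%:E =
   (population_loss F P u - population_loss F P x + c)%:E)%E.
Proof.
have ic : P.-integrable [set: T] (EFin \o cst c).
  apply: measurable_bounded_integrable => //.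
    by apply: le_lt_trans (probability_le1 P measurableT) _; rewrite ltry.
  exact: bounded_cst.
have iB := integrableB measurableT (Fi u) (Fi x).
rewrite [LHS](@integralD_EFin _ _ _ P _ measurableT (fun t => F u t - F x t) (cst c))//.
rewrite EFinD EFinB -!population_lossE; congr (_ + _)%E.
  exact: integralB_EFin.
exact: (integral_prob_cst P c%:E).
Qed.

Local Notation xh := (fun s : k.-tuple T => averaged_rule (observed F s)).

Lemma averaged_rule_norm1 (B : R) :
  (forall s : seq T, (size s < k)%N -> norm1 (strat (observed F s)) <= B) ->
  forall s : k.-tuple T, norm1 (xh s) <= B.
Proof.
move=> BP s; rewrite /= averaged_ruleE norm1Z ger0_norm// ler_pdivrMl ?ltr0n//.
apply: le_trans (norm1_sum _) _.
apply: (@le_trans _ _ (\sum_(i < k) B)).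
  by apply: ler_sum => i _; apply: BP; rewrite size_takel ?size_tuple// ltnW.
by rewrite sumr_const card_ord mulr_natl.
Qed.

Lemma integrable_population_loss_rule (B : R) :
  (forall s : k.-tuple T, norm1 (xh s) <= B) ->
  (iid_law P k).-integrable [set: k.-tuple T]
    (EFin \o (fun s => population_loss F P (xh s))).
Proof.
move=> BP; apply: measurable_bounded_integrable => //.
- by apply: le_lt_trans (probability_le1 _ measurableT) _; rewrite ltry.
- apply: (@measurable_caratheodory R n _ _ _ _
    (fun u (_ : k.-tuple T) => population_loss F P u) _ id) => //.
  + by move=> u v _; exact: population_loss_norm1.
  + exact: measurable_averaged_rule.
exists (`|population_loss F P 0| + B); split; first exact: num_real.
move=> b bB s _; apply: le_trans (ltW bB).
have := population_loss_norm1 (xh s) 0; have := population_loss_norm1 0 (xh s).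
rewrite sub0r subr0 norm1N; have := BP s.
have := ler_norm (population_loss F P 0).
have := ler_norm (- population_loss F P 0); rewrite normrN.
by rewrite ler_norml => *; apply/andP; split; lra.
Qed.

Lemma measurable_round_loss i x (c : R) : (i < k)%N ->
  measurable_fun [set: i.-tuple T * T]
    (fun p => (F (strat (observed F p.1)) p.2 - F x p.2 + c)%:E).
Proof.
move=> ik; apply/measurable_EFinP.
apply: (@measurable_caratheodory R n _ _ _ _ (fun u t => F u t - F x t + c)
  (fun p : i.-tuple T * T => strat (observed F p.1)) snd) => //.
- by move=> u' v' t; have := loss_class_norm1 u' v' t Fc; lra.
- have [_ mF _] := Fc => u'; apply: measurable_funD => //.
  exact: measurable_funB.
- move=> j; apply: (measurableT_comp
    (f := fun s : i.-tuple T => strat (observed F s) 0 j)) => //.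
  exact: (measurable_rule_augmented (strat_meas ik)).
Qed.

(** The [i]-th play is independent of the [i]-th sample, so that the expected
    regret is the expected excess risk of the plays, which by Jensen's inequality
    dominates that of their average. *)
Lemma averaged_rule_risk (w : R) x : X x ->
  (worst_regret (T * nat)%type X gamma k strat <= w%:E)%E ->
  (\int[iid_law P k]_s (population_loss F P (xh s))%:E <=
    (population_loss F P x + w)%:E)%E.
Proof.
move=> Xx ww; have [B B0 BP] := plays_bounded ww.
have kp : 0 < k%:R :> R by rewrite ltr0n.
(* adding c makes every round nonnegative, as Tonelli's theorem requires *)
pose c := B + M.
pose f := population_loss F P.
have cP (s : seq T) t : (size s < k)%N ->
    0 <= F (strat (observed F s)) t - F x t + c.
  move=> sk; have := loss_class_norm1 x (strat (observed F s)) t Fc.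
  have := norm1D x (- strat (observed F s)); rewrite norm1N.
  by have := BP s sk; have := XM Xx; rewrite /c; lra.
have fP (s : seq T) : (size s < k)%N -> 0 <= f (strat (observed F s)) - f x + c.
  move=> sk; rewrite -lee_fin -integral_shifted_loss; apply: integral_ge0 => t _.
  by rewrite lee_fin cP.
have sz (s : k.-tuple T) (i : 'I_k) : (size (take i s) < k)%N.
  by rewrite size_takel ?size_tuple// ltnW.
have mF (i : 'I_k) : measurable_fun [set: k.-tuple T] (fun s =>
    (F (strat (observed F (take i s))) (tnth s i) - F x (tnth s i) + c)%:E).
  rewrite (_ : (fun _ => _) = (fun p : i.-tuple T * T =>
      (F (strat (observed F p.1)) p.2 - F x p.2 + c)%:E) \o
      (fun s : k.-tuple T => (tuple_take (ltnW (ltn_ord i)) s, tnth s i))).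
    apply: measurableT_comp; first exact: measurable_round_loss.
    by apply: measurable_fun_pair;
      [exact: measurable_tuple_take|exact: measurable_tnth].
  by apply/funext => s; rewrite /= tuple_takeE.
have mG (i : 'I_k) : measurable_fun [set: k.-tuple T] (fun s =>
    (f (strat (observed F (take i s))) - f x + c)%:E).
  apply/measurable_EFinP.
  apply: (@measurable_caratheodory R n _ _ _ _
    (fun u (_ : k.-tuple T) => f u - f x + c) _ id) => //.
    by move=> u v _; have := population_loss_norm1 u v; rewrite /f; lra.
  exact: measurable_play.
have tower : (\int[iid_law P k]_s
    \sum_(i < k) (F (strat (observed F (take i s))) (tnth s i) - F x (tnth s i) + c)%:E
  = \int[iid_law P k]_s
    \sum_(i < k) (f (strat (observed F (take i s))) - f x + c)%:E)%E.
  rewrite ge0_integral_sum//; last first.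
    by move=> i s _; rewrite lee_fin cP.
  rewrite ge0_integral_sum//.
  - apply: eq_bigr => i _.
    have := @iid_law_tower _ _ _ P i k (ltn_ord i) (fun s t =>
      (F (strat (observed F s)) t - F x t + c)%:E) (measurable_round_loss x c (ltn_ord i)).
    rewrite (_ : Ordinal _ = i); last exact/val_inj.
    move=> ->.
      by apply: eq_integral => s _; rewrite integral_shifted_loss.
    by move=> s t; rewrite lee_fin cP// size_tuple.
  - by move=> i s _; rewrite lee_fin fP.
have intf := integrable_population_loss_rule (averaged_rule_norm1 BP).
have xhP s : k%:R * (f (xh s) - f x + c) <=
    \sum_(i < k) (f (strat (observed F (take i s))) - f x + c).
  have := jensen_mean (fun i : 'I_k => strat (observed F (take i s))) k0
    population_loss_convex.
  rewrite averaged_ruleE -/f big_split/= sumrB !sumr_const card_ord.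
  rewrite -[f x *+ k]mulr_natl -[c *+ k]mulr_natl => h.
  have := ler_wpM2l (ltW kp) h; rewrite mulrA mulfV ?gt_eqF// mul1r.
  by rewrite mulrDr mulrBr; lra.
have xh0 s : 0 <= f (xh s) - f x + c.
  have := averaged_rule_norm1 BP s; have := population_loss_norm1 x (xh s).
  have := norm1D x (- xh s); rewrite norm1N; have := XM Xx.
  by rewrite /c /f; lra.
have mxh : measurable_fun [set: k.-tuple T] (fun s => f (xh s)).
  by have /integrableP[/measurable_EFinP] := intf.
have ub : (\int[iid_law P k]_s (k%:R * (f (xh s) - f x + c))%:E <=
    (k%:R * (w + c))%:E)%E.
  apply: (@le_trans _ _ (\int[iid_law P k]_s
    \sum_(i < k) (f (strat (observed F (take i s))) - f x + c)%:E)%E).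
    apply: ge0_le_integral => //.
    - by move=> s _; rewrite lee_fin mulr_ge0.
    - apply/measurable_EFinP; apply: measurable_funM => //.
      by apply: measurable_funD => //; exact: measurable_funB.
    - exact: emeasurable_sum.
    - by move=> s _; rewrite sumEFin lee_fin.
  rewrite -tower -[leRHS](integral_prob_cst (iid_law P k)).
  apply: ge0_le_integral => //.
  - by move=> s _; apply: sume_ge0 => i _; rewrite lee_fin cP.
  - exact: emeasurable_sum.
  - move=> s _; rewrite sumEFin lee_fin big_split/= sumr_const card_ord.
    rewrite mulrDr [k%:R * c]mulr_natl lerD2r.
    exact: regret_le.
have iE : (\int[iid_law P k]_s (f (xh s))%:E)%E \is a fin_num.
  exact: integrable_fin_num intf.
move: ub; under eq_integral do rewrite -addrA mulrDr.
rewrite (integral_affine _ _ intf) -(fineK iE) -EFinM -EFinD !lee_fin -/f.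
move: (fine _) => I h; rewrite -(ler_pM2l kp) mulrDr; lra.
Qed.

Lemma averaged_rule_excess_risk (w : R) :
  (worst_regret (T * nat)%type X gamma k strat <= w%:E)%E ->
  (excess_risk X k averaged_rule F P <= w%:E)%E.
Proof.
move=> ww; have [B B0 BP] := plays_bounded ww.
have intf := integrable_population_loss_rule (averaged_rule_norm1 BP).
rewrite /excess_risk; set m := ereal_inf _.
have mle x : X x -> (m <= (population_loss F P x)%:E)%E.
  by move=> Xx; apply: ereal_inf_lbound; exists x.
have mfin : m \is a fin_num.
  rewrite fin_numElt; apply/andP; split; last first.
    by apply: le_lt_trans (mle 0 X0) _; rewrite ltry.
  apply: (@lt_le_trans _ _ (population_loss F P 0 - M)%:E); first by rewrite ltNyr.
  apply: le_ereal_inf_tmp => _ [x Xx <-]; rewrite lee_fin.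
  by have := population_loss_norm1 0 x; have := XM Xx; rewrite sub0r norm1N; lra.
rewrite /expected_loss -(fineK mfin); move: (fineK mfin); move: (fine m) => r rm.
have iZ : (iid_law P k).-integrable [set: k.-tuple T] (EFin \o
    (fun s : k.-tuple T => population_loss F P (xh s) - r)).
  have ir : (iid_law P k).-integrable [set: k.-tuple T] (EFin \o cst r).
    apply: measurable_bounded_integrable => //.
      by apply: le_lt_trans (probability_le1 _ measurableT) _; rewrite ltry.
    exact: bounded_cst.
  exact: (integrableB measurableT intf ir).
rewrite ifF; last first.
  apply/negbTE; rewrite -ltey.
  by apply: integrable_lty => //; exact: (integrable_funepos measurableT iZ).
have iE : (\int[iid_law P k]_s (population_loss F P (xh s))%:E)%E \is a fin_num.
  exact: integrable_fin_num intf.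
rewrite (_ : (\int[_]_w _)%E = (fine (\int[iid_law P k]_s
    (population_loss F P (xh s))%:E)%E - r)%:E); last first.
  rewrite EFinB (fineK iE).
  have := integral_affine 1 (- r) intf; rewrite mul1e EFinN => <-.
  by apply: eq_integral => s _; rewrite mul1r.
rewrite lee_fin lerBlDr addrC -lerBlDr -lee_fin rm.
apply: le_ereal_inf_tmp => _ [x Xx <-].
rewrite lee_fin lerBlDr -lee_fin (fineK iE).
exact: averaged_rule_risk.
Qed.
End augmented.

(** The estimator for [T] averages the plays of a strategy for [T * nat]: since
    the regret is a supremum over all sample spaces, enlarging the space costs
    nothing. *)
Lemma online_to_batch : (minimax_stochastic_risk k X gamma <= minimax_regret k X gamma)%E.
Proof.
apply: ge_ereal_sup => _ [d [T ->]].
apply: (@le_trans _ _ (ereal_inf [set worst_regret (T * nat)%type X gamma k strat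
  | strat in [set strat | forall i, (i < k)%N ->
      measurable_rule (T * nat)%type gamma i strat]])); last first.
  by apply: ereal_sup_ubound; exists _, (T * nat)%type.
apply: le_ereal_inf_tmp => _ [strat ms <-].
apply: ge_ereal_inf; exists (worst_excess_risk T X gamma k (averaged_rule strat)).
  exists (averaged_rule strat) => // F Fc.
  exact: measurable_averaged_rule.
apply: ge_ereal_sup => _ [F [P [Fc Fi ->]]].
case ww : (worst_regret (T * nat)%type X gamma k strat) => [w| |].
- by apply: averaged_rule_excess_risk; rewrite ?ww.
- by rewrite leey.
suff : (-oo < worst_regret (T * nat)%type X gamma k strat)%E by rewrite ww.
have [t _] : [set: T] !=set0.
  apply/set0P/eqP => T0; have := probability_setT P.
  by rewrite T0 measure0 => /eqP; rewrite eq_sym onee_eq0.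
pose s : k.-tuple (T * nat) := [tuple of nseq k (t, 0%N)].
apply: (@lt_le_trans _ _ (average_regret (augmented F 0) s
  (strategy_plays strat (augmented F 0) s) 0)%:E); first by rewrite ltNyr.
apply: ereal_sup_ubound; exists (augmented F 0), s, 0; split => //.
exact: augmented_loss_class.
Qed.
End online_to_batch.

(** * Finitely supported laws *)

Section finite_laws.
Context {R : realType} (I : finType).
Local Open Scope ereal_scope.

Definition code (a : I) : nat := enum_rank a.

Definition decode (a0 : I) (l : nat) : I :=
  if insub l is Some i then enum_val (i : 'I_#|I|) else a0.

Lemma codeK a0 a : decode a0 (code a) = a.
Proof. by rewrite /decode /code valK enum_rankK. Qed.

Variables (w : I -> R) (w0 : forall a, (0 <= w a)%R).

Definition atom_weight (l : nat) : {nonneg R} :=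
  if insub l is Some i then NngNum (w0 (enum_val (i : 'I_#|I|))) else NngNum (lexx (0%R : R)).

Definition finite_measure : {measure set nat -> \bar R} :=
  [the measure _ _ of
    msum (fun l => [the measure _ _ of mscale (atom_weight l) \d_l]) #|I|].

Lemma integral_finite_measure (Z : nat -> \bar R) : (forall l, 0 <= Z l) ->
  \int[finite_measure]_l Z l = \sum_a (w a)%:E * Z (code a).
Proof.
move=> Z0; rewrite ge0_integral_measure_sum//.
rewrite [RHS](reindex (@enum_val I predT)) /=; last first.
  by exists enum_rank => a _; [exact: enum_valK|exact: enum_rankK].
apply: eq_bigr => l _; rewrite ge0_integral_mscale//=.
rewrite integral_dirac// diracT mul1e /atom_weight valK /= /code enum_valK.
by [].
Qed.

Definition finite_law (w1 : (\sum_a w a = 1)%R) : set nat -> \bar R := finite_measure.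

Variable w1 : (\sum_a w a = 1)%R.

HB.instance Definition _ := Measure.on (finite_law w1).

Let finite_law_setT : finite_law w1 [set: nat] = 1.
Proof.
have := integral_finite_measure (Z := cst 1) (fun=> lee01).
rewrite integral_cst// mul1e => ->.
under eq_bigr do rewrite mule1.
by rewrite sumEFin w1.
Qed.

HB.instance Definition _ :=
  @Measure_isProbability.Build _ _ R (finite_law w1) finite_law_setT.

Lemma integral_finite_law (Z : nat -> \bar R) : (forall l, 0 <= Z l) ->
  \int[finite_law w1]_l Z l = \sum_a (w a)%:E * Z (code a).
Proof. exact: integral_finite_measure. Qed.

Definition finite_prob : probability nat R := [the probability _ _ of finite_law w1].
Local Notation P := finite_prob.

Lemma integrable_bounded (Z : nat -> R) (C : R) :
  (forall l, `|Z l| <= C)%R -> P.-integrable [set: nat] (EFin \o Z).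
Proof.
move=> ZC; apply: measurable_bounded_integrable => //.
  by apply: le_lt_trans (probability_le1 P measurableT) _; rewrite ltry.
exists C; split; first exact: num_real.
by move=> b Cb l _; apply: le_trans (ZC l) (ltW Cb).
Qed.

Lemma Rintegral_finite_law (Z : nat -> R) (C : R) : (forall l, `|Z l| <= C)%R ->
  (\int[P]_l Z l = \sum_a w a * Z (code a))%R.
Proof.
move=> ZC; have iZ := integrable_bounded ZC.
have := integral_affine 1 C iZ.
rewrite integral_finite_law; last first.
  move=> l; have := ZC l; rewrite ler_norml => /andP[h _].
  by rewrite lee_fin mul1r; lra.
under eq_bigr do rewrite -EFinM mul1r mulrDr.
have iE : \int[P]_l (Z l)%:E \is a fin_num by exact: integrable_fin_num iZ.
rewrite sumEFin big_split/= -mulr_suml w1 mul1r mul1e -(fineK iE) -EFinD.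
by move=> [] /addIr.
Qed.

Lemma sum_tupleS (V : nmodType) k (phi : k.+1.-tuple I -> V) :
  (\sum_(t : k.+1.-tuple I) phi t =
   \sum_a \sum_(t : k.-tuple I) phi [tuple of a :: t])%R.
Proof.
rewrite pair_big/= (reindex (fun p : I * k.-tuple I => [tuple of p.1 :: p.2]))//.
exists (fun t => (thead t, [tuple of behead t])) => [[a t] _|t _] /=.
  by congr (_, _); exact/val_inj.
by rewrite [RHS]tuple_eta; exact/val_inj.
Qed.

Lemma measurable_tuple_nat k d (T : measurableType d) (Z : k.-tuple nat -> T) :
  measurable_fun [set: k.-tuple nat] Z.
Proof.
move=> _ B _; rewrite setTI; set A := Z @^-1` B.
rewrite (_ : A = \bigcup_(l in [set l | exists2 t, A t & pickle t = l])
    [set t | pickle t = l]); last first.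
  apply/seteqP; split => [t At|t [_ [u Au <-]] /= /(pcan_inj pickleK) ->//].
  by exists (pickle t) => //; exists t.
apply: bigcup_measurable => _ [u _ <-].
rewrite (_ : [set t | _] = \bigcap_(i in [set: 'I_k]) (@tnth k nat)^~ i @^-1` [set tnth u i]).
  apply: fin_bigcap_measurable => // i _; rewrite -[X in measurable X]setTI.
  exact: measurable_tnth.
apply/seteqP; split => [t /= /(pcan_inj pickleK) -> i _//|t /= tu].
by congr pickle; apply: eq_from_tnth => i; exact: tu.
Qed.

Lemma integral_iid_finite_law k (Z : k.-tuple nat -> \bar R) : (forall t, 0 <= Z t) ->
  \int[iid_law P k]_s Z s =
  \sum_(t : k.-tuple I) (\prod_(i < k) w (tnth t i))%:E * Z [tuple of map code t].
Proof.
elim: k Z => [|k IH] Z Z0.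
  rewrite [LHS]integral_dirac//; last exact: measurable_tuple_nat.
  rewrite diracT mul1e (big_pred1 [tuple]) => [|t]; last by apply/esym/eqP; exact: tuple0.
  by rewrite big_ord0 mul1e; congr Z; exact/val_inj.
rewrite iid_law_integralS//; last exact: measurable_tuple_nat.
rewrite integral_finite_law; last by move=> l; exact: integral_ge0.
rewrite sum_tupleS; apply: eq_bigr => a _; rewrite IH//.
rewrite ge0_sume_distrr; last first.
  by move=> t _; rewrite mule_ge0// lee_fin prodr_ge0.
apply: eq_bigr => t _; rewrite muleA -EFinM big_ord_recl/=.
congr ((_ * _)%:E * Z _); last exact/val_inj.
by apply: eq_bigr => i _; rewrite tnthS.
Qed.

Lemma sum_prod_tuple k (g : I -> R) :
  (\sum_(t : k.-tuple I) \prod_(i < k) g (tnth t i) = (\sum_a g a) ^+ k)%R.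
Proof.
elim: k => [|k IH].
  by rewrite (big_pred1 [tuple]) ?big_ord0// => t; apply/esym/eqP; exact: tuple0.
rewrite sum_tupleS exprS -IH mulr_suml; apply: eq_bigr => a _.
rewrite mulr_sumr; apply: eq_bigr => t _; rewrite big_ord_recl/=.
by congr (_ * _)%R; apply: eq_bigr => i _; rewrite tnthS.
Qed.
End finite_laws.

(** * The hard instance *)

Section hard_instance.
Context {R : realType} (m n : nat) (mn : (m <= n)%N) (delta : R).
Hypothesis delta01 : 0 <= delta <= 1.
Local Notation I := {ffun 'I_m -> bool}.
Local Notation V := ('I_m * bool)%type.
Implicit Types (a : I) (v : V) (x : 'rV[R]_n).

(** The samples are sign vectors [a], and the hypothesis [v = (j, b)] says that
    coordinate [j] of the sample is biased towards [(-1) ^ b]; [corr] is 1 when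
    the sample agrees with it and -1 otherwise. *)
Definition corr v a : R := (-1) ^+ (v.2 (+) a v.1).

Definition flip a : I := [ffun j => ~~ a j].

Definition flip1 j a : I := [ffun i => (i == j) (+) a i].

Lemma flipK : involutive flip.
Proof. by move=> a; apply/ffunP => j; rewrite !ffunE negbK. Qed.

Lemma flip1K j : involutive (flip1 j).
Proof. by move=> a; apply/ffunP => i; rewrite !ffunE addbA addbb. Qed.

Lemma corr_flip v a : corr v (flip a) = - corr v a.
Proof. by rewrite /corr ffunE addbN signrN. Qed.

Lemma corr_sqr v a : corr v a * corr v a = 1.
Proof. by rewrite -expr2 sqrr_sign. Qed.

Lemma corr_norm v a : `|corr v a| = 1.
Proof. exact: normr_sign. Qed.

Lemma sum_corr v : \sum_a corr v a = 0.
Proof.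
suff : \sum_a corr v a = - \sum_a corr v a by lra.
rewrite [LHS](reindex_inj (inv_inj flipK)) /= -sumrN.
by apply: eq_bigr => a _; exact: corr_flip.
Qed.

(** Distinct hypotheses are uncorrelated or opposite. *)
Lemma sum_corr2 v v' : v != v' -> \sum_a corr v a * corr v' a <= 0.
Proof.
move=> vv'; have [jj|jj] := eqVneq v.1 v'.1.
  apply: sumr_le0 => a _; rewrite /corr jj -signr_addb addbACA addbb addbF.
  have -> : v.2 (+) v'.2 = true.
    apply: contraNeq vv'; rewrite [v]surjective_pairing [v']surjective_pairing.
    by rewrite xpair_eqE jj eqxx/=; case: (v.2); case: (v'.2).
  by rewrite expr1; lra.
suff : \sum_a corr v a * corr v' a = - \sum_a corr v a * corr v' a by lra.
rewrite [LHS](reindex_inj (inv_inj (flip1K v.1))) /= -sumrN.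
apply: eq_bigr => a _.
rewrite /corr !ffunE eqxx [v'.1 == _]eq_sym (negbTE jj) /= addbN signrN.
by rewrite mulNr.
Qed.

Definition uniform_weight : R := #|I|%:R^-1.

Lemma uniform_weight_gt0 : 0 < uniform_weight.
Proof. by rewrite invr_gt0 ltr0n card_ffun card_bool expn_gt0. Qed.

Lemma sum_uniform (c : R) : \sum_(a : I) uniform_weight * c = c.
Proof.
rewrite sumr_const -[_ *+ #|I|]mulr_natl mulrA mulfV ?mul1r//.
by rewrite pnatr_eq0 card_ffun card_bool -lt0n expn_gt0.
Qed.

Definition biased v a : R := uniform_weight * (1 + delta * corr v a).

Lemma biased_ge0 v a : 0 <= biased v a.
Proof.
have := corr_norm v a; move: delta01 => /andP[d0 d1].
move=> /eqP; rewrite eqr_norml => /andP[/orP[/eqP|/eqP] c1 _]; rewrite /biased c1;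
  by rewrite mulr_ge0 ?(ltW uniform_weight_gt0)//; lra.
Qed.

Lemma sum_biased v : \sum_a biased v a = 1.
Proof.
rewrite /biased; under eq_bigr do rewrite mulrDr.
rewrite big_split/= sum_uniform -mulr_sumr -mulr_sumr sum_corr !mulr0 addr0//.
Qed.

Definition sign_vector a : 'rV[R]_n :=
  \row_i (if insub (nat_of_ord i) is Some j then (-1) ^+ a j else 0).

Definition best_response v : 'rV[R]_n :=
  (- (-1) ^+ v.2) *: delta_mx 0 (widen_ord mn v.1).

Lemma sign_vector_flip a : sign_vector (flip a) = - sign_vector a.
Proof.
apply/rowP => i; rewrite !mxE; case: insub => [j|]; last by rewrite oppr0.
by rewrite ffunE signrN.
Qed.

Lemma dotp_best_response v a : dotp (sign_vector a) (best_response v) = - corr v a.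
Proof.
rewrite dotpZr dotp_delta mxE /= valK mulNr /corr signr_addb//.
Qed.

(** The truncation at -1 leaves nothing to gain beyond the best response of a hypothesis,
    so that no point can do well under two of them. *)
Definition hinge (u : R) : R := Num.max u (-1).

Definition hinge_risk (w : I -> R) x : R := \sum_a w a * hinge (dotp (sign_vector a) x).

Lemma hinge_pair (p q u : R) : 0 <= p -> 0 <= q ->
  - `|p - q| <= p * hinge u + q * hinge (- u).
Proof.
move=> p0 q0; have [pq|pq] := leP q p.
  rewrite ger0_norm ?subr_ge0// /hinge.
  by case: (leP u (-1)); case: (leP (- u) (-1)); nra.
rewrite ltr0_norm ?subr_lt0// /hinge.
by case: (leP u (-1)); case: (leP (- u) (-1)); nra.
Qed.

(** Pairing opposite sign vectors: only the asymmetry of the weights can make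
    the risk of a point negative. *)
Lemma hinge_risk_ge (w : I -> R) x : (forall a, 0 <= w a) ->
  - (\sum_a `|w a - w (flip a)|) / 2 <= hinge_risk w x.
Proof.
move=> w0.
have h : hinge_risk w x =
    \sum_a w (flip a) * hinge (- dotp (sign_vector a) x).
  rewrite /hinge_risk (reindex_inj (inv_inj flipK))/=.
  by apply: eq_bigr => a _; rewrite sign_vector_flip dotpNl.
suff : - (\sum_a `|w a - w (flip a)|) <= hinge_risk w x + hinge_risk w x by lra.
rewrite {2}h -big_split/= -sumrN; apply: ler_sum => a _.
exact: hinge_pair.
Qed.

(** The excess of [x] over the best response, whose risk is [- delta]; losses are
    divided by 4 to bring their subgradients into the dual ball. *)
Definition excess v x : R := (hinge_risk (biased v) x + delta) / 4.

Lemma excess_ge0 v x : 0 <= excess v x.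
Proof.
have := hinge_risk_ge x (biased_ge0 v).
suff -> : \sum_a `|biased v a - biased v (flip a)| = 2 * delta.
  by rewrite /excess; lra.
move: delta01 => /andP[d0 d1].
rewrite -[RHS]sum_uniform; apply: eq_bigr => a _.
rewrite /biased corr_flip -mulrBr.
rewrite (_ : _ - _ = 2 * delta * corr v a); last by ring.
by rewrite !normrM corr_norm mulr1 !ger0_norm// (ltW uniform_weight_gt0).
Qed.

(** The sum of two biased laws is at most as asymmetric under a flip as each of
    them alone, since the biases reinforce each other no more often than they cancel.
    The two risks thus add up to at least [- delta], when the best responses
    would reach [- 2 * delta]. *)
Lemma excess_separation v v' x : v != v' -> delta / 4 <= excess v x + excess v' x.
Proof.
move=> vv'; move: delta01 => /andP[d0 d1].
have w0 a : 0 <= biased v a + biased v' a by rewrite addr_ge0// biased_ge0.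
have := hinge_risk_ge x w0.
have -> : hinge_risk (fun a => biased v a + biased v' a) x =
    hinge_risk (biased v) x + hinge_risk (biased v') x.
  by rewrite /hinge_risk -big_split; apply: eq_bigr => a _; rewrite mulrDl.
suff : \sum_a `|biased v a + biased v' a - (biased v (flip a) + biased v' (flip a))|
    <= 2 * delta by rewrite /excess; lra.
have -> : \sum_a `|biased v a + biased v' a - (biased v (flip a) + biased v' (flip a))|
   = 2 * delta * (1 + uniform_weight * \sum_a corr v a * corr v' a).
  rewrite mulrDr mulr1 -{1}(sum_uniform (2 * delta)) !mulr_sumr -big_split/=.
  apply: eq_bigr => a _; rewrite /biased !corr_flip.
  rewrite (_ : _ - _ = uniform_weight * (2 * delta * (corr v a + corr v' a))); last by ring.
  rewrite normrM (gtr0_norm uniform_weight_gt0) normrM (ger0_norm (_ : 0 <= 2 * delta)).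
    2: by rewrite mulr_ge0.
  have -> : `|corr v a + corr v' a| = 1 + corr v a * corr v' a.
    rewrite /corr; case: (_ (+) _); case: (_ (+) _); rewrite ?expr0 ?expr1.
    - by rewrite ltr0_norm; lra.
    - by rewrite addNr normr0; lra.
    - by rewrite subrr normr0; lra.
    - by rewrite ger0_norm; lra.
  by ring.
rewrite ler_piMr// ?mulr_ge0// gerDl mulr_ge0_le0// ?(ltW uniform_weight_gt0)//.
exact: sum_corr2.
Qed.

Lemma hinge_risk_best_response v :
  hinge_risk (biased v) (best_response v) = - delta.
Proof.
rewrite /hinge_risk.
transitivity (\sum_a (- (uniform_weight * delta) - uniform_weight * corr v a)).
  apply: eq_bigr => a _; rewrite dotp_best_response /hinge max_l; last first.
    by rewrite lerN2 -(corr_norm v a) ler_norm.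
  rewrite /biased -[LHS](addrK (uniform_weight * delta * (corr v a * corr v a))).
  by rewrite {2}corr_sqr; ring.
by rewrite big_split/= !sumrN sum_uniform -mulr_sumr sum_corr mulr0 subr0.
Qed.
End hard_instance.

(** * Testing among 2 m hypotheses *)

Section bayes.
Context {R : realType} (m n : nat) (mn : (m <= n)%N) (delta : R).
Hypothesis delta01 : 0 <= delta <= 1.
Hypothesis m0 : (0 < m)%N.
Variable k : nat.
Local Notation I := {ffun 'I_m -> bool}.
Local Notation V := ('I_m * bool)%type.
Local Notation N := ((2 * m)%N%:R : R).
Hypothesis dk : (1 + delta ^+ 2) ^+ k <= 5 / 8 * N.

Definition law v (t : k.-tuple I) : R := \prod_(i < k) biased delta v (tnth t i).

Lemma law_ge0 v t : 0 <= law v t.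
Proof. by apply: prodr_ge0 => i _; exact: biased_ge0. Qed.

Lemma sum_law v : \sum_t law v t = 1.
Proof. by rewrite /law sum_prod_tuple sum_biased expr1n. Qed.

Lemma sum_V (c : R) : \sum_(v : V) c = N * c.
Proof.
by rewrite sumr_const card_prod card_ord card_bool -[LHS]mulr_natl mulnC.
Qed.

(** A guess [b] names at most one hypothesis per sample. Against the uniform law
    the likelihood ratio [L] has second moment [(1 + delta ^ 2) ^ k], so that
    bounding [L * b] by [lam / 2 * L ^ 2 + b / (2 * lam)] shows that the guess
    cannot be right for nearly all the hypotheses at once. *)
Lemma correct_guesses (b : V -> k.-tuple I -> bool) :
  (forall t v v', b v t -> b v' t -> v = v') ->
  \sum_v \sum_t law v t * (b v t)%:R <= 4 / 5 * N.
Proof.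
move=> b1.
have N0 : 0 < N by rewrite ltr0n muln_gt0.
pose U := (@uniform_weight R m) ^+ k.
have U0 : 0 <= U by rewrite exprn_ge0// ltW// uniform_weight_gt0.
pose L (v : V) (t : k.-tuple I) : R := \prod_(i < k) (1 + delta * corr v (tnth t i)).
have lawE v t : law v t = U * L v t.
  by rewrite /law /biased big_split/= prodr_const card_ord.
have L2 v : \sum_t U * L v t ^+ 2 = (1 + delta ^+ 2) ^+ k.
  transitivity (\sum_(t : k.-tuple I) \prod_(i < k)
      (@uniform_weight R m * (1 + delta * corr v (tnth t i)) ^+ 2)).
    apply: eq_bigr => t _; rewrite big_split/= prodr_const card_ord.
    by rewrite -prodrXl.
  rewrite (sum_prod_tuple k (fun a : I => uniform_weight m * (1 + delta * corr v a) ^+ 2)).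
  congr (_ ^+ k).
  transitivity (\sum_a (@uniform_weight R m * (1 + delta ^+ 2) +
      uniform_weight m * (2 * delta) * corr v a)).
    apply: eq_bigr => a _; have := @corr_sqr R _ v a; move: (corr v a) => c cc.
    rewrite (_ : (1 + delta * c) ^+ 2 = 1 + 2 * delta * c + delta ^+ 2 * (c * c)).
      by rewrite cc; ring.
    by ring.
  by rewrite big_split/= sum_uniform -mulr_sumr sum_corr mulr0 addr0.
have UT : \sum_(t : k.-tuple I) U = 1.
  transitivity (\sum_(t : k.-tuple I) \prod_(i < k) @uniform_weight R m).
    by apply: eq_bigr => t _; rewrite prodr_const card_ord.
  rewrite (sum_prod_tuple k (fun a : I => uniform_weight m)).
  by under eq_bigr do rewrite -[uniform_weight m]mulr1; rewrite sum_uniform expr1n.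
have bsum t : \sum_v (b v t)%:R <= 1 :> R.
  have [[v bv]|nb] := pselect (exists v, b v t).
    rewrite (bigD1 v)//= bv big1 ?addr0// => v' vv'.
    apply/eqP; rewrite pnatr_eq0 eqb0; apply: contra vv' => bv'.
    by apply/eqP; exact: b1 bv' bv.
  rewrite big1 ?ler01// => v _; apply/eqP; rewrite pnatr_eq0 eqb0.
  by apply/negP => bv; apply: nb; exists v.
(* lam is of the order of 1 / N, the fraction of the hypotheses that a guess names *)
pose lam := 5 / 4 / N.
apply: (@le_trans _ _ (\sum_v \sum_t
    (lam / 2 * (U * L v t ^+ 2) + 2 / 5 * N * (U * (b v t)%:R)))).
  apply: ler_sum => v _; apply: ler_sum => t _; rewrite lawE.
  have bb : (b v t)%:R * (b v t)%:R = (b v t)%:R :> R.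
    by case: (b v t); rewrite ?mulr1 ?mulr0.
  rewrite -{2}bb /lam; move: (b v t)%:R (L v t) => c l; move: N N0 => N' N0'.
  rewrite -subr_ge0 (_ : _ - _ = U * (5 / 4 / N' / 2 * (l - c * (4 / 5 * N')) ^+ 2)).
    by rewrite mulr_ge0// mulr_ge0 ?sqr_ge0// !divr_ge0// ltW.
  by field; rewrite gt_eqF.
under eq_bigr do rewrite big_split/= -mulr_sumr L2 -mulr_sumr -mulr_sumr.
rewrite big_split/= sum_V -mulr_sumr -mulr_sumr.
have h1 : N * (lam / 2 * (1 + delta ^+ 2) ^+ k) <= 25 / 64 * N.
  rewrite mulrA; apply: le_trans (ler_wpM2l _ dk) _.
    by rewrite /lam !mulr_ge0// ?invr_ge0 ltW.
  rewrite le_eqVlt; apply/orP; left; apply/eqP; rewrite /lam.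
  by move: N N0 => N' N0'; field; rewrite gt_eqF.
have h2 : U * (\sum_v \sum_t (b v t)%:R) <= 1.
  rewrite exchange_big/= -[leRHS]UT mulr_sumr; apply: ler_sum => t _.
  by rewrite -[leRHS]mulr1 ler_wpM2l.
have := ler_wpM2l (ltW N0) h2; lra.
Qed.

(** Any rule fails with probability at least [1 / 5] on average over the
    hypotheses, and every failure costs [delta / 8], because two distinct
    hypotheses share no good point. *)
Lemma hard_hypothesis (p : k.-tuple I -> 'rV[R]_n) :
  exists v, delta / 40 <= \sum_t law v t * excess delta v (p t).
Proof.
move: (delta01) => /andP[d0 d1].
have N0 : 0 < N by rewrite ltr0n muln_gt0.
pose b (v : V) (t : k.-tuple I) := excess delta v (p t) < delta / 8.
have b1 (t : k.-tuple I) (v v' : V) : b v t -> b v' t -> v = v'.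
  move=> bv bv'; apply/eqP; apply: contraT => /excess_separation.
  by move=> /(_ R n delta delta01 (p t)); rewrite /b in bv bv'; lra.
have := correct_guesses b1 => bad.
apply: contrapT => /forallNP nv.
have : \sum_v \sum_t law v t * excess delta v (p t) < \sum_(v : V) delta / 40.
  apply: ltr_sum => [|v _]; last by rewrite ltNge; apply/negP; exact: nv.
  by apply/hasP; exists (Ordinal m0, true); rewrite // mem_index_enum.
have : \sum_v \sum_t law v t * (delta / 8 * (1 - (b v t)%:R)) <=
    \sum_v \sum_t law v t * excess delta v (p t).
  apply: ler_sum => v _; apply: ler_sum => t _; apply: ler_wpM2l; first exact: law_ge0.
  rewrite /b; case: ltP => h; first by rewrite subrr mulr0 excess_ge0.
  by rewrite subr0 mulr1.
have -> : \sum_v \sum_t law v t * (delta / 8 * (1 - (b v t)%:R)) =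
    delta / 8 * (N - \sum_v \sum_t law v t * (b v t)%:R).
  rewrite -[N]mulr1 -sum_V -sumrB mulr_sumr; apply: eq_bigr => v _.
  rewrite -[X in _ = _ * (X - _)](sum_law v) -sumrB mulr_sumr.
  by apply: eq_bigr => t _; ring.
rewrite sum_V => h1 h2.
have d8 : 0 <= delta / 8 by lra.
have := ler_wpM2l d8 bad; move: h1 h2; rewrite mulrBr; lra.
Qed.
End bayes.

Section lower_bound.
Context {R : realType} (m n : nat) (mn : (m <= n)%N).
Local Notation I := {ffun 'I_m -> bool}.
Local Notation V := ('I_m * bool)%type.

Definition hinge_loss (x : 'rV[R]_n) (l : nat) : R :=
  hinge (dotp (sign_vector n (decode ([ffun=> false] : I) l)) x) / 4.

Lemma hinge_lipschitz (u u' : R) : hinge u - hinge u' <= `|u - u'|.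
Proof.
have := ler_norm (u - u'); have := normr_ge0 (u - u').
by rewrite /hinge; case: (leP u (-1)); case: (leP u' (-1)); lra.
Qed.

Lemma sign_vector_coord (a : I) (i : 'I_n) :
  `|sign_vector n a 0 i : R| = (if (i < m)%N then 1 else 0).
Proof.
rewrite mxE; case: insubP => [j im _|/negbTE ->]; last by rewrite normr0.
by rewrite im normr_sign.
Qed.

Lemma hinge_loss_class (gamma : 'rV[R]_n -> R) :
  (forall g : 'rV[R]_n,
     (forall i : 'I_n, `|g 0 i| <= (if (i < m)%N then 1 / 4 else 0)) ->
     gamma g <= 1) ->
  loss_class gamma hinge_loss.
Proof.
move=> gP; split.
- move=> l; apply/convex_functionP => t x y /andP[t0 t1]; rewrite /hinge_loss.
  rewrite dotpDr !dotpZr; move: (dotp _ x) (dotp _ y) => u u'.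
  suff : hinge (t * u + (1 - t) * u') <= t * hinge u + (1 - t) * hinge u' by lra.
  have g (s : R) : s <= hinge s by rewrite /hinge le_max lexx.
  have h (s : R) : -1 <= hinge s by rewrite /hinge le_max lexx orbT.
  have t1' : 0 <= 1 - t by lra.
  rewrite {1}/hinge ge_max; apply/andP; split.
    by apply: lerD; exact: ler_wpM2l.
  by have := ler_wpM2l t0 (h u); have := ler_wpM2l t1' (h u'); lra.
- by move=> x; by [].
- move=> x l g gx; apply: gP => i.
  pose s : 'rV[R]_n := sign_vector n (decode ([ffun=> false] : I) l).
  have st : hinge_loss (x + delta_mx 0 i) l - hinge_loss x l <= `|s 0 i| / 4.
    rewrite /hinge_loss -/s dotpDr dotp_delta.
    by have := hinge_lipschitz (dotp s x + s 0 i) (dotp s x); rewrite addrAC subrr add0r; lra.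
  have st' : hinge_loss (x - delta_mx 0 i) l - hinge_loss x l <= `|s 0 i| / 4.
    rewrite /hinge_loss -/s dotpDr dotpNr dotp_delta.
    have := hinge_lipschitz (dotp s x - s 0 i) (dotp s x).
    by rewrite addrAC subrr add0r normrN; lra.
  have := gx (x + delta_mx 0 i); have := gx (x - delta_mx 0 i).
  rewrite [x - _ - x]addrC addKr [x + _ - x]addrC addKr dotpNr !dotp_delta => h1 h2.
  have -> : (if (i < m)%N then 1 / 4 else 0) = `|s 0 i| / 4.
    by rewrite sign_vector_coord; case: ifP => _ //; rewrite mul0r.
  by rewrite ler_norml; apply/andP; split; lra.
Qed.

Variable delta : R.
Hypothesis delta01 : 0 <= delta <= 1.

Definition biased_prob (v : V) : probability nat R :=
  finite_prob (biased_ge0 delta01 v) (sum_biased delta v).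

Lemma hinge_loss_bounded x l : `|hinge_loss x l| <= norm1 x + 1.
Proof.
rewrite /hinge_loss; set s := sign_vector _ _.
have : `|dotp s x| <= norm1 x.
  apply: le_trans (ler_norm_sum _ _ _) _; apply: ler_sum => i _.
  rewrite normrM ler_piMl// sign_vector_coord; case: ifP => _ //.
move: (dotp s x) (norm1_ge0 x) => u x0; rewrite ler_norml => /andP[u1 u2].
rewrite ler_norml /hinge; apply/andP.
by case: (leP u (-1)) => h; split; lra.
Qed.

Lemma population_hinge_loss v x :
  population_loss hinge_loss (biased_prob v) x = hinge_risk (biased delta v) x / 4.
Proof.
rewrite /population_loss (Rintegral_finite_law _ _ (hinge_loss_bounded x)).
rewrite /hinge_risk mulr_suml; apply: eq_bigr => a _.
by rewrite /hinge_loss codeK mulrA.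
Qed.

Lemma excess_risk_ge (X : set 'rV[R]_n) k (xhat : seq ('rV[R]_n -> R) -> 'rV[R]_n) v :
  X (best_response mn v) ->
  ((\sum_(t : k.-tuple I) law delta v t * excess delta v
      (xhat (observed hinge_loss [tuple of map (@code I) t])))%:E <=
    excess_risk X k xhat hinge_loss (biased_prob v))%E.
Proof.
move=> Xb; rewrite /excess_risk /expected_loss.
set iid := iid_law _ k; set r := ereal_inf _.
pose e (s : k.-tuple nat) : R := excess delta v (xhat (observed hinge_loss s)).
have e0 s : (0 <= (e s)%:E)%E by rewrite lee_fin excess_ge0.
have rb : (r <= (- (delta / 4))%:E)%E.
  apply: ereal_inf_lbound; exists (best_response mn v) => //.
  by rewrite population_hinge_loss hinge_risk_best_response mulNr.
pose Z (s : k.-tuple nat) : \bar R :=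
  ((population_loss hinge_loss (biased_prob v) (xhat (observed hinge_loss s)))%:E - r)%E.
have eZ s : ((e s)%:E <= Z s)%E.
  have -> : e s = population_loss hinge_loss (biased_prob v)
      (xhat (observed hinge_loss s)) - - (delta / 4).
    by rewrite population_hinge_loss /e /excess opprK mulrDl.
  by rewrite EFinB leeB.
rewrite -/Z; case: ifP => [_|_]; first by rewrite leey.
apply: (@le_trans _ _ (\int[iid]_s (e s)%:E)%E); last first.
  by apply: ge0_le_integral => //; exact: measurable_tuple_nat.
rewrite integral_iid_finite_law// -sumEFin.
by apply: lee_sum => t _; rewrite -EFinM.
Qed.

(** The condition on [delta] says that [k] samples carry too little information
    to tell [2 m] hypotheses apart. *)
Lemma stochastic_risk_ge (gamma : 'rV[R]_n -> R) (X : set 'rV[R]_n) k :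
  (0 < m)%N ->
  (forall g : 'rV[R]_n,
     (forall i : 'I_n, `|g 0 i| <= (if (i < m)%N then 1 / 4 else 0)) ->
     gamma g <= 1) ->
  (forall v, X (best_response mn v)) ->
  (1 + delta ^+ 2) ^+ k <= 5 / 8 * (2 * m)%N%:R ->
  ((delta / 40)%:E <= minimax_stochastic_risk k X gamma)%E.
Proof.
move=> m0 gP XP dk.
have Fc := hinge_loss_class gP.
apply: (@le_trans _ _ (ereal_inf [set worst_excess_risk nat X gamma k xhat
  | xhat in measurable_rule nat gamma k])); last first.
  by apply: ereal_sup_ubound; exists _, nat.
apply: le_ereal_inf_tmp => _ [xhat _ <-].
have [v vP] := hard_hypothesis delta01 m0 dk
  (fun t : k.-tuple I => xhat (observed hinge_loss [tuple of map (@code I) t])).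
apply: (@le_trans _ _ (excess_risk X k xhat hinge_loss (biased_prob v))).
  by apply: le_trans (excess_risk_ge k xhat (XP v)); rewrite lee_fin.
apply: ereal_sup_ubound; exists hinge_loss, (biased_prob v); split => //.
by move=> x; exact: (integrable_bounded _ _ (hinge_loss_bounded x)).
Qed.
End lower_bound.

Section lower_rate.
Context {R : realType} (m n : nat) (mn : (m <= n)%N).

(** With [delta ^ 2] at most a quarter of [ln (2 m) / k], the second moment
    [(1 + delta ^ 2) ^ k <= exp (k * delta ^ 2)] stays below [(2 m) ^ (1 / 4)]. *)
Lemma stochastic_risk_rate (gamma : 'rV[R]_n -> R) (X : set 'rV[R]_n) k :
  (0 < m)%N -> (0 < k)%N ->
  (forall g : 'rV[R]_n,
     (forall i : 'I_n, `|g 0 i| <= (if (i < m)%N then 1 / 4 else 0)) ->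
     gamma g <= 1) ->
  (forall v, X (best_response mn v)) ->
  ((80^-1 * Num.min 1 (Num.sqrt (ln (2 * m)%N%:R / k%:R)))%:E <=
    minimax_stochastic_risk k X gamma)%E.
Proof.
move=> m0 k0 gP XP.
set N : R := (2 * m)%N%:R.
have N2 : 2 <= N by rewrite ler_nat -[X in (X <= _)%N]muln1 leq_mul2l.
have kp : 0 < k%:R :> R by rewrite ltr0n.
have lnN : 0 <= ln N by rewrite ln_ge0//; lra.
set r := Num.min _ _; pose delta := r / 2.
have r0 : 0 <= r by rewrite /r le_min ler01 sqrtr_ge0.
have r1 : r <= 1 by rewrite /r ge_min lexx.
have rs : r ^+ 2 <= ln N / k%:R.
  rewrite -[leRHS]sqr_sqrtr ?divr_ge0// ?(ltW kp)//.
  by rewrite ler_pXn2r ?nnegrE ?sqrtr_ge0// /r ge_min lexx orbT.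
have d01 : 0 <= delta <= 1 by rewrite /delta; apply/andP; split; lra.
have -> : 80^-1 * r = delta / 40 by rewrite /delta; field.
apply: (@stochastic_risk_ge _ _ _ mn _ d01) => //.
rewrite -/N -(@ler_pXn2r _ 4) ?nnegrE//; last 2 first.
- by rewrite exprn_ge0// addr_ge0// sqr_ge0.
- by lra.
apply: (@le_trans _ _ N); last first.
  have : 8 <= N ^+ 3.
    have N0 : 0 <= N by lra.
    rewrite (_ : 8 = 2 ^+ 3 :> R); last by ring.
    by rewrite ler_pXn2r ?nnegrE.
  have quartic (y : R) : (5 / 8 * y) ^+ 4 = 625 / 4096 * y ^+ 3 * y by field.
  move=> h; rewrite quartic.
  by rewrite ler_peMl//; lra.
rewrite -exprM -[leRHS](@lnK R); last by rewrite posrE; lra.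
apply: (@le_trans _ _ (expR (delta ^+ 2) ^+ (k * 4))).
  by apply: lerXn2r; rewrite ?nnegrE ?addr_ge0 ?sqr_ge0 ?expR_ge0 ?expR_ge1Dx.
rewrite -expRM_natl ler_expR natrM.
move: rs; rewrite ler_pdivlMr//; apply: le_trans; rewrite le_eqVlt; apply/orP; left.
have quarter_sq (x y : R) : x * 4 * (y / 2) ^+ 2 = y ^+ 2 * x by field.
by rewrite /delta quarter_sq.
Qed.
End lower_rate.

(** * Dual norms and the choice of exponents *)

Section numeric_bounds.
Context {R : realType}.

Lemma ln2_ge : 2^-1 <= ln 2 :> R.
Proof.
have := @le_ln1Dx R (- 2^-1); rewrite (_ : 1 + - 2^-1 = 2^-1 :> R); last by field.
by rewrite lnV ?posrE//; lra.
Qed.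

Lemma ln2_le : ln 2 <= 3 / 4 :> R.
Proof.
rewrite -ler_expR lnK ?posrE//.
rewrite (_ : 3 / 4 = 8%:R * (3 / 32) :> R); last by field.
rewrite expRM_natl; apply: (@le_trans _ _ ((1 + 3 / 32) ^+ 8)); first by lra.
by apply: lerXn2r; rewrite ?nnegrE ?expR_ge0 ?expR_ge1Dx//; lra.
Qed.

Lemma expR1_le4 : expR 1 <= 4 :> R.
Proof.
have h : 2^-1 <= expR (- 2^-1) :> R by apply: le_trans (expR_ge1Dx _); lra.
rewrite (_ : 1 = - (2%:R * - 2^-1) :> R); last by field.
rewrite expRN expRM_natl -[leRHS]invrK lef_pV2 ?posrE ?exprn_gt0 ?expR_gt0//.
apply: (@le_trans _ _ (2^-1 ^+ 2)); first by lra.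
by apply: lerXn2r; rewrite ?nnegrE ?expR_ge0.
Qed.

(** [m ^ t <= exp (t * ln (2 m)) <= exp 1]: a dimension raised to the inverse of
    its logarithm is a constant. *)
Lemma natr_powR_le4 (m : nat) (t : R) : (0 < m)%N -> 0 <= t ->
  t * ln (2 * m)%N%:R <= 1 -> m%:R `^ t <= 4.
Proof.
move=> m0 t0 tm; have mp : (0 : R) < m%:R by rewrite ltr0n.
apply: le_trans expR1_le4; rewrite /powR gt_eqF// ler_expR.
apply: le_trans tm; rewrite ler_wpM2l// ler_ln ?posrE ?ltr0n ?muln_gt0//.
by rewrite ler_nat leq_pmull.
Qed.

End numeric_bounds.

Section dual_norm.
Context {R : realType} (n : nat) (p : R).
Hypothesis p1 : 1 <= p.
Implicit Types (g x : 'rV[R]_n) (A : {pred 'I_n}).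
Local Notation gamma := (@lpnorm R n (hoelder_conjugate p%:E)).

Lemma hoelder_conjugate_cases :
  p = 1 /\ hoelder_conjugate p%:E = +oo%E \/
  exists q : R, [/\ 0 < q, p^-1 + q^-1 = 1 & hoelder_conjugate p%:E = q%:E].
Proof.
move: p1; rewrite le_eqVlt => /predU1P[<-|p1'].
  by left; split => //; exact: hoelder_conjugate1.
have p0 : p != 0 by rewrite gt_eqF//; lra.
have pp0 : p - 1 != 0 by rewrite gt_eqF//; lra.
right; exists (p / (p - 1)); split.
- by rewrite divr_gt0; lra.
- by field; apply/andP.
by rewrite /hoelder_conjugate/= eqe (negbTE p0) -EFinB inver (negbTE pp0).
Qed.

Lemma coord_le_dual g j : `|g 0 j| <= gamma g.
Proof.
have [[_ ->]|[q [q0 _ ->]]] := hoelder_conjugate_cases.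
  exact: (le_bigmax 0 (fun j => `|g 0 j|)).
by rewrite lpnormE coord_le_pnorm.
Qed.

Lemma pnorm_sparse (q c : R) A g : 0 < q -> 0 <= c ->
  (forall i, `|g 0 i| <= (if i \in A then c else 0)) ->
  pnorm q g <= c * #|A|%:R `^ q^-1.
Proof.
move=> q0 c0 gA; have iq0 : 0 <= q^-1 by rewrite invr_ge0 ltW.
have -> : c * #|A|%:R `^ q^-1 = (c `^ q * #|A|%:R) `^ q^-1.
  by rewrite powRM ?powR_ge0// -powRrM mulfV ?gt_eqF// powRr1.
rewrite pnormE ge0_ler_powR ?nnegrE ?powsum_ge0 ?mulr_ge0 ?powR_ge0//.
rewrite mulr_natr -sumr_const [leRHS]big_mkcond/=; apply: ler_sum => i _.
have := gA i; case: ifPn => _ gi; first by rewrite ge0_ler_powR ?nnegrE ?(ltW q0).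
have -> : `|g 0 i| = 0 by apply/eqP; rewrite -normr_le0 normr_id.
by rewrite powR0// gt_eqF.
Qed.

(** For a finite conjugate exponent [q] the power of the cardinal is
    [1 / q = (p - 1) / p <= p - 1]; for [p = 1] it is 0. *)
Lemma dual_sparse (c : R) A g : 0 <= c -> (0 < #|A|)%N ->
  (forall i, `|g 0 i| <= (if i \in A then c else 0)) ->
  gamma g <= c * #|A|%:R `^ (p - 1).
Proof.
move=> c0 A0 gA.
have [[-> ->]|[q [q0 pq ->]]] := hoelder_conjugate_cases.
  rewrite subrr powRr0 mulr1; apply: bigmax_le => // i _.
  by apply: le_trans (gA i) _; case: ifP.
rewrite lpnormE; apply: le_trans (pnorm_sparse q0 c0 gA) _.
rewrite ler_wpM2l// ler_powR ?ler1n//.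
have -> : q^-1 = (p - 1) / p.
  have p0 : p != 0 by rewrite gt_eqF// (lt_le_trans ltr01 p1).
  by rewrite mulrBl mulfV// mul1r -pq addrAC subrr add0r.
by rewrite ler_pdivrMr ?(lt_le_trans ltr01 p1)// ler_peMr ?subr_ge0.
Qed.

Lemma dual_delta j (c : R) : `|c| <= 1 -> gamma (c *: delta_mx 0 j) <= 1.
Proof.
move=> c1; have := @dual_sparse 1 (pred1 j) (c *: delta_mx 0 j).
rewrite card1 powR1 mulr1; apply => // i.
rewrite !mxE eqxx inE/=; case: eqP => _; first by rewrite mulr1.
by rewrite mulr0 normr0.
Qed.

Lemma dual0 : (0 < n)%N -> gamma 0 <= 1.
Proof.
move=> n0; rewrite -(scale0r (delta_mx 0 (Ordinal n0))); apply: dual_delta.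
by rewrite normr0.
Qed.

Lemma dual_prefix (m : nat) g : (0 < m <= n)%N -> (p - 1) * ln (2 * m)%N%:R <= 1 ->
  (forall i : 'I_n, `|g 0 i| <= (if (i < m)%N then 1 / 4 else 0)) -> gamma g <= 1.
Proof.
move=> /andP[m0 mn] pm gm; pose A := [pred i : 'I_n | (i < m)%N].
have cA : #|A| = m by rewrite -sum1_card -(big_ord_widen n (fun=> 1%N) mn) sum1_card card_ord.
have := @dual_sparse (1 / 4) A g; rewrite cA => h.
have m4 : m%:R `^ (p - 1) <= 4 by apply: natr_powR_le4; rewrite ?subr_ge0.
have /le_trans -> // : gamma g <= 1 / 4 * m%:R `^ (p - 1).
  by apply: h => //; lra.
by lra.
Qed.

Lemma lpballE x : lpball p%:E x = (pnorm p x <= 1).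
Proof. by rewrite -lpnormE. Qed.

Lemma lpball_coord x j : lpball p%:E x -> `|x 0 j| <= 1.
Proof.
rewrite lpballE; apply: le_trans.
by rewrite coord_le_pnorm// (lt_le_trans ltr01 p1).
Qed.

Lemma lpball0 : lpball p%:E (0 : 'rV[R]_n).
Proof. by rewrite lpballE pnorm0 ?(lt_le_trans ltr01 p1). Qed.

Lemma lpball_norm1 x : lpball p%:E x -> norm1 x <= n%:R.
Proof.
move=> Xx; rewrite /norm1 -[leRHS]mulr_natl mulr1 -[in leRHS](card_ord n) -sumr_const.
by apply: ler_sum => j _; exact: lpball_coord.
Qed.

Lemma lpball_best_response m (mn : (m <= n)%N) v : lpball p%:E (@best_response R m n mn v).
Proof.
have p0 := lt_le_trans ltr01 p1.
rewrite lpballE; set j := widen_ord mn v.1.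
have := @pnorm_sparse p 1 (pred1 j) (best_response mn v) p0 ler01.
rewrite card1 powR1 mulr1; apply => i.
rewrite !mxE eqxx inE/= -/j; case: eqP => _; last by rewrite mulr0 normr0.
by rewrite mulr1 normrN normrX normrN1 expr1n.
Qed.

Lemma lpball_pnorm (a : R) x : p <= a -> lpball p%:E x -> pnorm a x <= 1.
Proof.
move=> pa Xx; have p0 := lt_le_trans ltr01 p1.
have := Xx; rewrite lpballE !pnorm_le1// ?(lt_le_trans p0 pa)//.
apply: le_trans; apply: ler_sum => j _; have xj := lpball_coord j Xx.
have [->|x0] := eqVneq `|x 0 j| 0.
  by rewrite !powR0// ?gt_eqF// (lt_le_trans p0 pa).
rewrite -(subrKC p a) powRD ?(negbTE x0) ?implybT// ler_piMr ?powR_ge0//.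
have ap : 0 <= a - p by rewrite subr_ge0.
by have := ge0_ler_powR ap _ _ xj; rewrite powR1; apply; rewrite nnegrE.
Qed.

End dual_norm.

Section exponents.
Context {R : realType} (n : nat) (p : R).
Hypothesis n1 : (1 <= n)%N.
Hypothesis p12 : 1 <= p <= 2.
Let L : R := ln (2 * n)%N%:R.
Let a : R := Num.max (1 + 1 / L) p.
Local Notation gamma := (@lpnorm R n (hoelder_conjugate p%:E)).

Lemma ln_double_ge : 2^-1 <= L.
Proof.
apply: le_trans ln2_ge _; rewrite /L ler_ln ?posrE ?ltr0n ?muln_gt0//.
by rewrite ler_nat leq_pmulr.
Qed.

(** In dimension at least 2, [L >= ln 4 >= 1] keeps [a] below 2; in dimension 1,
    [L = ln 2 >= 1 / 2] keeps it below 3. *)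
Lemma admissible_exponent : @admissible R n a.
Proof.
have L2 := ln_double_ge; have L0 : 0 < L by apply: lt_le_trans L2; rewrite invr_gt0.
have a1 : 1 < a by rewrite /a lt_max ltrDl divr_gt0.
move/andP: p12 => [_ p2].
rewrite /admissible a1/=; have [n2|n2] := leqP 2 n; last first.
  have -> : n == 1%N by rewrite eqn_leq n1 -ltnS n2.
  apply/orP; right; rewrite /= /a ge_max (le_trans p2) ?ler_nat// andbT.
  by rewrite -lerBrDl ler_pdivrMr//; lra.
apply/orP; left; rewrite /a ge_max p2 andbT.
have L1 : 1 <= L.
  apply: (@le_trans _ _ (ln (2 ^+ 2))); last first.
    rewrite /L ler_ln ?posrE ?ltr0n ?muln_gt0 ?exprn_gt0//.
    by rewrite -natrX ler_nat (leq_mul2l 2 2).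
  by rewrite lnXn// -[leRHS]mulr_natl; have := @ln2_ge R; lra.
by rewrite -lerBrDl ler_pdivrMr//; lra.
Qed.

(** When [a] exceeds [p] the coordinates of [g] are still bounded by 1, and the
    norm dual to the [l_a] norm costs a factor [n ^ (1 - 1 / a) <= n ^ (1 / L)],
    at most 4. *)
Lemma dual_pairing (g v : 'rV[R]_n) : gamma g <= 1 ->
  `|dotp g v| <= 4 * pnorm a v.
Proof.
move=> g1; move/andP: (p12) => [p1 _].
have L0 : 0 < L by apply: lt_le_trans ln_double_ge; rewrite invr_gt0.
have a1 : 1 < a by rewrite /a lt_max ltrDl divr_gt0.
have a0 : 0 < a by lra.
have [pL|pL] := leP p (1 + 1 / L).
  have aE : a = 1 + 1 / L by rewrite /a; apply/max_idPl.
  pose q := a / (a - 1); have q0 : 0 < q by rewrite divr_gt0// subr_gt0.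
  have aq : a^-1 + q^-1 = 1.
    by rewrite /q; field; rewrite !gt_eqF// subr_gt0.
  apply: le_trans (hoelder_dotp _ _ a0 q0 aq) _; rewrite ler_wpM2r ?pnorm_ge0//.
  have := @pnorm_sparse R n q 1 predT g q0 ler01; rewrite mul1r card_ord => h.
  apply: le_trans (h _) _ => [i|].
    by apply: le_trans (coord_le_dual p1 _ _) _.
  apply: natr_powR_le4; rewrite ?invr_ge0 ?(ltW q0)//.
  have aL : a - 1 = L^-1 by rewrite aE addrAC subrr add0r div1r.
  by rewrite -/L /q invf_div aL mulrAC mulVf ?gt_eqF// div1r invf_le1 ?(ltW a1).
have aE : a = p by rewrite /a; apply/max_idPr; exact: ltW.
rewrite aE; have p0 : 0 < p by lra.
have [[p1' _]|[q [q0 pq hq]]] := hoelder_conjugate_cases p1.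
  by move: a1; rewrite aE p1' ltxx.
apply: le_trans (hoelder_dotp _ _ p0 q0 pq) _; rewrite ler_wpM2r ?pnorm_ge0//.
by move: g1; rewrite hq lpnormE => /le_trans; apply; lra.
Qed.

(** The logarithm of the effective dimension is of the order of [1 / (p - 1)]:
    [2 m] is [exp (1 / (p - 1))] up to a factor 2. It is at most [n] precisely
    because [p] is above the threshold, and the dual norm of a vector of [m]
    small coordinates is then bounded. *)
Lemma effective_dimension : 1 + 1 / L < p -> exists m : nat,
  [/\ (0 < m <= n)%N, (p - 1) * ln (2 * m)%N%:R <= 1
    & 4^-1 * (1 / (p - 1)) <= ln (2 * m)%N%:R].
Proof.
move=> pL; move/andP: (p12) => [_ p2].
have L0 : 0 < L by apply: lt_le_trans ln_double_ge; rewrite invr_gt0.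
have iL0 : 0 < 1 / L by rewrite divr_gt0.
have pp0 : 0 < p - 1 by lra.
pose t := 1 / (p - 1); rewrite -/t.
have t1 : 1 <= t by rewrite /t ler_pdivlMr//; lra.
have tL : t < L.
  by rewrite /t ltr_pdivrMr// mulrC -ltr_pdivrMr//; lra.
pose y := expR t / 2.
have y1 : 1 <= y by rewrite /y; have := @expR_ge1Dx R t; lra.
have /andP[my ym] := @truncn_itv R y (le_trans ler01 y1).
set m := Num.trunc y in my ym *.
have m0 : (0 < m)%N.
  by move: (le_lt_trans y1 ym); rewrite ltr1n ltnS.
have m1 : (1 : R) <= m%:R by rewrite ler1n.
have tm0 : (0 : R) < (2 * m)%:R by rewrite ltr0n muln_gt0.
exists m; split.
- rewrite m0/= -(@leq_pmul2l 2)// -(@ler_nat R) natrM.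
  apply: (@le_trans _ _ (expR t)); first by move: my; rewrite /y; lra.
  rewrite -[leRHS](@lnK R) ?posrE ?ltr0n ?muln_gt0// ler_expR.
  exact: ltW.
- rewrite mulrC -ler_pdivlMr// -/t -ler_expR lnK ?posrE// natrM.
  by move: my; rewrite /y; lra.
- have : ln y <= ln (2 * m)%:R.
    rewrite ler_ln ?posrE ?(lt_le_trans ltr01 y1)// natrM.
    by move: ym; rewrite -natr1; lra.
  rewrite /y ln_div ?posrE ?expR_gt0// expRK.
  by have := @ln2_le R; lra.
Qed.

End exponents.

Lemma min1_half_le (R : realType) (u v : R) : 0 <= u -> 4^-1 * u <= v ->
  2^-1 * Num.min 1 (Num.sqrt u) <= Num.min 1 (Num.sqrt v).
Proof.
move=> u0 uv; have su := sqrtr_ge0 u.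
have h : 2^-1 * Num.sqrt u <= Num.sqrt v.
  rewrite (_ : 2^-1 = Num.sqrt (2^-1 ^+ 2)); last by rewrite sqrtr_sqr ger0_norm.
  rewrite -sqrtrM ?sqr_ge0// ler_wsqrtr// (le_trans _ uv)//.
  by rewrite ler_wpM2r//; lra.
rewrite le_min; apply/andP; split.
  have : Num.min 1 (Num.sqrt u) <= 1 by rewrite ge_min lexx.
  lra.
apply: le_trans h; rewrite ler_wpM2l ?invr_ge0//.
by rewrite ge_min lexx orbT.
Qed.

Theorem theorem3 (R : realType) :
  exists c C : R, [/\ 0 < c, c <= C &
  forall (n k : nat) (p : R), (1 <= n)%N -> (1 <= k)%N -> 1 <= p <= 2 ->
  let X : set 'rV[R]_n := lpball p%:E in
  let gamma : 'rV[R]_n -> R := lpnorm (hoelder_conjugate p%:E) in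
  let L : R := ln (2 * n)%:R in
  let a : R := Num.max (1 + 1 / L) p in
  let h : 'rV[R]_n -> R := fun x => 1 / (2 * (a - 1)) * lpnorm a%:E x ^+ 2 in
  let rate1 : R := Num.min 1 (Num.sqrt (L / k%:R)) in
  let rate2 : R := Num.min 1 (Num.sqrt (1 / (k%:R * (p - 1)))) in
  (p <= 1 + 1 / L ->
    [/\ ((c * rate1)%:E <= minimax_stochastic_risk k X gamma)%E,
        (minimax_stochastic_risk k X gamma <= minimax_regret k X gamma)%E,
        (minimax_regret k X gamma <= (C * rate1)%:E)%E
      & mirror_descent_attains h k X gamma (C * rate1)]) /\
  (1 + 1 / L < p ->
    [/\ ((c * rate2)%:E <= minimax_stochastic_risk k X gamma)%E,
        (minimax_stochastic_risk k X gamma <= minimax_regret k X gamma)%E,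
        (minimax_regret k X gamma <= (C * rate2)%:E)%E
      & mirror_descent_attains h k X gamma (C * rate2)])].

Proof.
exists 160^-1, 71; split=> [||n k p n1 k1 p12 X gamma L a h rate1 rate2].
- by rewrite invr_gt0.
- lra.
have /andP[p1 p2] := p12.
have adm : admissible a := admissible_exponent n1 p12.
have pair : forall g, gamma g <= 1 -> forall v, `|dotp g v| <= 4 * pnorm a v.
  by move=> g g1 v; exact: dual_pairing.
have pa : p <= a by rewrite /a le_max lexx orbT.
have Xa x : X x -> pnorm a x <= 1 by exact: lpball_pnorm.
have hE : h = dgf a by apply/funext => x; rewrite /h lpnormE.
have upper := minimax_regret_rate adm k1 pair Xa.
have descent := mirror_descent_rate adm k1 pair Xa.
have middle : (minimax_stochastic_risk k X gamma <= minimax_regret k X gamma)%E.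
  apply: (@online_to_batch _ _ _ _ _ n%:R) => //.
  - by move=> g j; apply: le_trans; exact: coord_le_dual.
  - by move=> j c; exact: dual_delta.
  - exact: dual0.
  - exact: lpball0.
  - by move=> x; exact: lpball_norm1.
have lower m : (0 < m <= n)%N -> (p - 1) * ln (2 * m)%N%:R <= 1 ->
    ((80^-1 * Num.min 1 (Num.sqrt (ln (2 * m)%N%:R / k%:R)))%:E <=
      minimax_stochastic_risk k X gamma)%E.
  move=> mn pm; have /andP[m0 mn'] := mn.
  apply: (@stochastic_risk_rate _ m n mn') => // [g|v].
    exact: dual_prefix.
  exact: lpball_best_response.
have L0 : 0 < L by apply: lt_le_trans (@ln_double_ge R n n1); rewrite invr_gt0.
have kp : 0 < k%:R :> R by rewrite ltr0n.
split=> pL.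
  have rateE : Num.min 1 (Num.sqrt (1 / (k%:R * (a - 1)))) = rate1.
    have -> : a = 1 + 1 / L by rewrite /a; apply/max_idPl.
    by rewrite /rate1 addrAC subrr add0r; congr (Num.min 1 (Num.sqrt _)); field;
      rewrite !gt_eqF.
  rewrite hE; split=> //; rewrite -?rateE//.
  rewrite rateE; apply: (@le_trans _ _ (80^-1 * rate1)%:E).
    rewrite lee_fin ler_wpM2r ?le_min ?ler01 ?sqrtr_ge0//; lra.
  (* all the coordinates are used *)
  apply: lower; first by rewrite n1 leqnn.
  by rewrite -ler_pdivlMr// -/L; lra.
have aE : a = p by rewrite /a; apply/max_idPr; exact: ltW.
rewrite hE; split=> //; rewrite /rate2 -?aE//.
have [m [mn pm mt]] := effective_dimension n1 p12 pL.
apply: le_trans (lower m mn pm).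
have iL0 : 0 < 1 / L by rewrite divr_gt0.
have pp0 : 0 < p - 1 by lra.
rewrite aE lee_fin (_ : 160^-1 = 80^-1 * 2^-1); last by field.
rewrite -mulrA ler_wpM2l ?invr_ge0//; apply: min1_half_le.
  by rewrite divr_ge0// mulr_ge0// (ltW pp0).
rewrite ler_pdivlMr//; apply: le_trans mt.
rewrite le_eqVlt; apply/orP; left; apply/eqP.
by move: k%:R kp => K K0; field; rewrite (gt_eqF K0) (gt_eqF pp0).
Qed.
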